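(* Let $k,j$ be positive integers with $k\geq j$. The complete tic-tac-toe arrangement $\overline{\mathcal{T}}_k^j$ of type $(k,j)$ admits a unique unexpected curve of degree $2(k+j+1)$.
   Context: Tic-tac-toe arrangements: in the projective plane $\mathbb{P}^2=\mathbb{P}^2_{\mathbb{C}}$ with coordinates $x,y,z$, the tic-tac-toe arrangement $\mathcal{T}_k^j$ of type $(k,j)$ consists of the vertical lines $v_i:\ x=iz$ and the horizontal lines $h_i:\ y=iz$ for $i=-k,\dots,k$, together with the diagonals $d_i:\ x-y+iz=0$ and the anti-diagonals $e_i:\ x+y+iz=0$ for $i=-j,\dots,j$. The complete tic-tac-toe arrangement $\overline{\mathcal{T}}_k^j$ is obtained from $\mathcal{T}_k^j$ by adding the line at infinity $z=0$. Duality: the line $\{p_0y_0+p_1y_1+p_2y_2=0\}$ is dual to the point $(p_0:p_1:p_2)$; the dual configuration of a line arrangement $\mathcal{A}$ is the set $Z$ of points dual to the lines of $\mathcal{A}$. Unexpected curves: let $S=\mathbb{C}[x_0,x_1,x_2]$ with the standard grading; for a homogeneous ideal $I$ write $[I]_i$ for its degree $i$ part. For a finite set $Z$ of reduced points in $\mathbb{P}^2$ with homogeneous ideal $I(Z)$, a point $Q$ with ideal $I(Q)$ and an integer $t$, put $I(Z+tQ)=I(Z)\cap I(Q)^t$. The set $Z$ admits unexpected curves of degree $t+1$ if for a general point $Q\in\mathbb{P}^2$ one has $\dim_{\mathbb{C}}[I(Z+tQ)]_{t+1}>\max\{\dim_{\mathbb{C}}[I(Z)]_{t+1}-\binom{t+1}{2},0\}$;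 in this case the unexpected curves of degree $t+1$ are the curves defined by nonzero elements of $[I(Z+tQ)]_{t+1}$, for $Q$ general. ''Admits a unique unexpected curve of degree $t+1$'' means that $Z$ admits unexpected curves of degree $t+1$ and, for general $Q$, $\dim_{\mathbb{C}}[I(Z+tQ)]_{t+1}=1$. A line arrangement is said to admit unexpected curves if its dual configuration of points does. *)

(* Defs.v *)
From HB Require Import structures.
From mathcomp Require Import all_boot all_order all_algebra.
From mathcomp Require Import reals.
From mathcomp Require Import complex mpoly.

Set Implicit Arguments.
Unset Strict Implicit.
Unset Printing Implicit Defensive.

Import Order.TTheory GRing.Theory Num.Theory.
Local Open Scope ring_scope.

Section UnexpectedCurves.
Context {R : realType}.

(* The field of complex numbers is [R[i]] for [R] the field of real numbers. *)
Local Notation C := R[i].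
Local Notation S := {mpoly C[3]}.

(* A point of the projective plane is given by a nonzero vector of homogeneous
   coordinates; the ideals below do not change when this vector is rescaled. *)
Definition ev (f : S) (p : 'rV[C]_3) : C := f.@[fun i => p 0 i].

(* A polynomial belongs to the homogeneous ideal of a point when it vanishes at
   all the homogeneous coordinate vectors of that point. *)
Definition ideal_pt (q : 'rV[C]_3) (f : S) : Prop :=
  forall c : C, ev f (c *: q) = 0.

Definition ideal_pts (Z : seq 'rV[C]_3) (f : S) : Prop :=
  forall p, p \in Z -> ideal_pt p f.

(* The ideal generated by the products of [t] elements of [I]. *)
Definition ideal_exp (I : S -> Prop) (t : nat) (f : S) : Prop :=
  exists (n : nat) (a : 'I_n -> S) (g : 'I_n -> 'I_t -> S),
    (forall i j, I (g i j)) /\ f = \sum_(i < n) a i * \prod_(j < t) g i j.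

Definition ideal_fat (Z : seq 'rV[C]_3) (t : nat) (q : 'rV[C]_3) (f : S) : Prop :=
  ideal_pts Z f /\ ideal_exp (ideal_pt q) t f.

(* [dim_part I d m] : the degree [d] part of [I] is a vector subspace, of
   dimension [m], of the space [dhomog 3 C d] of forms of degree [d]. *)
Definition dim_part (I : S -> Prop) (d m : nat) : Prop :=
  exists2 V : {vspace dhomog 3 C d},
    forall f : dhomog 3 C d, f \in V <-> I (mpoly_of_dhomog f) & \dim V = m.

(* The common zeros of a set of polynomials. *)
Definition zeros (F : S -> Prop) (q : 'rV[C]_3) : Prop :=
  forall f, F f -> ev f q = 0.

(* [P] holds on a nonempty Zariski open subset of the projective plane. *)
Definition for_general_point (P : 'rV[C]_3 -> Prop) : Prop :=
  exists F : S -> Prop,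
    [/\ forall f, F f -> exists d : nat, f \is d.-homog,
        exists q : 'rV[C]_3, q != 0 /\ ~ zeros F q
      & forall q : 'rV[C]_3, q != 0 -> ~ zeros F q -> P q].

Definition admits_unexpected_curves (Z : seq 'rV[C]_3) (d : nat) : Prop :=
  exists2 t : nat, d = t.+1 &
  for_general_point (fun q => exists m n : nat,
    [/\ dim_part (ideal_fat Z t q) t.+1 m,
        dim_part (ideal_pts Z) t.+1 n
      & Num.max (n%:Z - 'C(t.+1, 2)%:Z) 0 < m%:Z]).

Definition admits_unique_unexpected_curve (Z : seq 'rV[C]_3) (d : nat) : Prop :=
  admits_unexpected_curves Z d /\
  exists2 t : nat, d = t.+1 &
  for_general_point (fun q => dim_part (ideal_fat Z t q) t.+1 1).

(* A line is given by a linear form defining it, and the line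
   [p0 y0 + p1 y1 + p2 y2 = 0] is dual to the point [(p0 : p1 : p2)]. *)
Definition dual_pt (l : S) : 'rV[C]_3 := \row_(i < 3) l@_(U_(i)).

Definition dual_config (A : seq S) : seq 'rV[C]_3 := [seq dual_pt l | l <- A].

Local Notation x := ('X_(0 : 'I_3) : S).
Local Notation y := ('X_(1 : 'I_3) : S).
Local Notation z := ('X_(2 : 'I_3) : S).

(* The integers from [- k] to [k]. *)
Definition sym_range (k : nat) : seq int :=
  [seq i%:Z - k%:Z | i <- iota 0 (2 * k + 1)].

Definition tictactoe (k j : nat) : seq S :=
  [seq x - i%:~R *: z | i <- sym_range k] ++
  [seq y - i%:~R *: z | i <- sym_range k] ++
  [seq x - y + i%:~R *: z | i <- sym_range j] ++
  [seq x + y + i%:~R *: z | i <- sym_range j].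

Definition complete_tictactoe (k j : nat) : seq S := z :: tictactoe k j.

End UnexpectedCurves.

(* Main.v *)
From HB Require Import structures.
Require Import Defs.
From mathcomp Require Import all_boot all_order all_algebra.
From mathcomp Require Import reals.
From mathcomp Require Import complex mpoly.
From mathcomp Require Import separable boolp.
From mathcomp Require Import ring zify.

(** A point q of the plane is dual to the line L of the points p with q.p = 0,
    and a vector field theta of degree t in the dual plane yields the form
    X |-> X.theta(q x X), of degree t+1, where q x X is the point dual to the
    line through q and X.  This form has a t-fold point at q, because q x X
    vanishes to first order at X = q, and it vanishes at the point dual to a
    line H as soon as theta is tangent to H.  So a field of degree
    t = 2(k+j)+1 tangent to every line of the arrangement produces a curve of
    degree 2(k+j+1) for every q.

    The field is (T(x,y), T(y,x), 0), where T(x,y) is the product of the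
    vertical lines ([parallels]) by a polynomial of degree 2j, even in x and
    in y ([pade]).  Tangency to the vertical and horizontal lines is built in,
    parity reduces the anti-diagonals to the diagonals, and what remains is
    that T(x,y) - T(y,x) vanishes on x - y = i for |i| <= j ([defect_eq0]).
    In top degree this says that pade(Y,X)/pade(X,Y), as a function of X = x^2
    and Y = y^2, approximates (X/Y)^(k+1/2) at X = Y to order 2j+1, which is
    the diagonal Pade approximation; as for Pade approximants, a three-term
    recurrence in j gives the solution.  Going from j+1 to j+2 amounts to the
    vanishing of a combination of two restrictions to the diagonal
    x - y = j+2 ([defect_combination]).  That combination has degree at most
    2k, since its coefficients are polynomials of small degree in the
    intercept of the diagonal with many roots ([size_defect]), and it has
    2k+1 roots: the points of the grid on that diagonal, counted twice when
    an anti-diagonal passes through them, and the point with x = -k, where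
    [pade] factors completely ([pade_boundary]).

    Uniqueness.  A form g of degree t+1 with a t-fold point at q satisfies
    g(X + mu q) = g(X) + mu h(X) ([fat_pencil]).  If g and the curve f above
    both pass through the 4(k+j)+5 points, then along a line not through q
    the combination g h_f - f h_g has degree at most 2t = 4(k+j)+2 but
    4(k+j)+4 roots, so it vanishes.  For general q the restrictions of f and
    h_f are coprime: their common zeros are zeros of the field on L, the
    Wronskian of two consecutive Pade polynomials ([pade_wronskian]) puts
    those on the lines of the arrangement, and L avoids the finitely many
    points of each line where the field vanishes.  Hence g is a multiple of f
    ([fat_unique]).

    Finally the points impose independent conditions on the forms of degree
    t+1 ([separated]), so the expected dimension of the system is
    binom(t+3,2) - (4(k+j)+5) - binom(t+1,2) = 0, and the curve is
    unexpected. *)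

Set Implicit Arguments.
Unset Strict Implicit.
Unset Printing Implicit Defensive.
Import Order.TTheory GRing.Theory Num.Theory.
Local Open Scope ring_scope.

(** * A vector field tangent to vertical and horizontal lines *)

Lemma sym_rangeS m :
  perm_eq (sym_range m.+1) (m.+1%:Z :: - m.+1%:Z :: sym_range m).
Proof.
rewrite /sym_range (_ : 2 * m.+1 + 1 = 1 + (2 * m + 1) + 1)%N; last lia.
have [l def_l] : exists l, l = (2 * m + 1)%N by exists (2 * m + 1)%N.
rewrite -def_l !iotaD !map_cat perm_catC /= sub0r.
rewrite (_ : (0 + _)%:Z - _ = m.+1%:Z); last lia.
rewrite !perm_cons (iotaDl 1) -map_comp.
by rewrite (@eq_map _ _ _ (fun i : nat => i%:Z - m%:Z)) // => i /=; lia.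
Qed.

Lemma mem_sym_range m (i : int) : (i \in sym_range m) = (`|i| <= m%:Z).
Proof.
apply/mapP/idP => [[l]|le_im]; first by rewrite mem_iota => ? ->; lia.
exists `|(i + m%:Z)%R|%N; last lia.
by rewrite mem_iota; lia.
Qed.

Lemma sym_range_uniq m : uniq (sym_range m).
Proof. by rewrite map_inj_uniq ?iota_uniq // => i l /=; lia. Qed.

Lemma size_sym_range m : size (sym_range m) = (2 * m + 1)%N.
Proof. by rewrite size_map size_iota. Qed.

Section LinesAndForms.
Variable R : comNzRingType.
Implicit Types (x y z c u : R) (k j m : nat).

Definition parallels m x z : R := \prod_(i <- sym_range m) (x - i%:~R * z).

(** The recurrence is that of the diagonal Pade approximants of r^(k+1/2),
    corrected by lower order terms: the squares subtracted from x - y and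
    x + y make the second term vanish on the diagonals and anti-diagonals of
    intercept l, and on the diagonals of intercept j both coefficients become
    multiples of (x + y)^2 - l^2 z^2.  Over an arbitrary commutative ring,
    x, y, z can be numbers, univariate polynomials or forms. *)
Fixpoint pade k x y z j : R :=
  if j is l.+1 then
    if l is i.+1 then
      (2 * l + 1)%:R * (2 * (x ^+ 2 + y ^+ 2) - (j ^ 2 + l ^ 2)%:R * z ^+ 2)
        * pade k x y z l
      + ((2 * k + 1)%:R ^+ 2 - (4 * l ^ 2)%:R)
        * ((x - y) ^+ 2 - (l ^ 2)%:R * z ^+ 2)
        * ((x + y) ^+ 2 - (l ^ 2)%:R * z ^+ 2) * pade k x y z i
    else 2 * (x ^+ 2 + y ^+ 2) - z ^+ 2 - (2 * k + 1)%:R * (x ^+ 2 - y ^+ 2)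
  else 1.

(** The first component of the vector field; exchanging x and y gives the
    second one, and the third one is zero. *)
Definition tangent k j x y z : R := parallels k x z * pade k x y z j.

Lemma pade1 k x y z :
  pade k x y z 1 =
    2 * (x ^+ 2 + y ^+ 2) - z ^+ 2 - (2 * k + 1)%:R * (x ^+ 2 - y ^+ 2).
Proof. by []. Qed.

Lemma padeSS k x y z j :
  pade k x y z j.+2 =
    (2 * j + 3)%:R * (2 * (x ^+ 2 + y ^+ 2)
        - (j.+2 ^ 2 + j.+1 ^ 2)%:R * z ^+ 2) * pade k x y z j.+1
    + ((2 * k + 1)%:R ^+ 2 - (4 * j.+1 ^ 2)%:R)
      * ((x - y) ^+ 2 - (j.+1 ^ 2)%:R * z ^+ 2)
      * ((x + y) ^+ 2 - (j.+1 ^ 2)%:R * z ^+ 2) * pade k x y z j.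
Proof. by rewrite [LHS]/= (_ : 2 * j.+1 + 1 = 2 * j + 3)%N //; lia. Qed.

Arguments pade : simpl never.

Lemma pade_ind (P : nat -> Prop) :
  P 0 -> P 1 -> (forall j, P j -> P j.+1 -> P j.+2) -> forall j, P j.
Proof.
move=> P0 P1 PS j; suff [] : P j /\ P j.+1 by [].
by elim: j => [|j [Pj Pj1]]; split=> //; apply: PS.
Qed.

Lemma parallels0 x z : parallels 0 x z = x.
Proof. by rewrite /parallels /sym_range big_seq1 subr0 mul0r subr0. Qed.

Lemma parallelsS m x z :
  parallels m.+1 x z = (x ^+ 2 - (m.+1 ^ 2)%:R * z ^+ 2) * parallels m x z.
Proof.
rewrite /parallels (perm_big _ (sym_rangeS m)) !big_cons.
rewrite [LHS]mulrA; congr (_ * _); rewrite intrN -pmulrn; ring.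
Qed.

Lemma parallelsN m x z : parallels m (- x) z = - parallels m x z.
Proof.
by elim: m => [|m IH]; rewrite ?parallels0 ?parallelsS ?IH ?mulrN ?sqrrN.
Qed.

Lemma parallelsZ m c x z :
  parallels m (c * x) (c * z) = c ^+ (2 * m + 1) * parallels m x z.
Proof.
elim: m => [|m IH]; first by rewrite !parallels0 expr1.
rewrite !parallelsS IH (_ : (2 * m.+1 + 1 = (2 * m + 1) + 2)%N) ?exprD; last lia.
ring.
Qed.

Lemma padeNl k x y z j : pade k (- x) y z j = pade k x y z j.
Proof.
by elim/pade_ind: j => [//||j IH IH1]; rewrite ?padeSS ?pade1 ?IH ?IH1; ring.
Qed.

Lemma padeNr k x y z j : pade k x (- y) z j = pade k x y z j.
Proof.
by elim/pade_ind: j => [//||j IH IH1]; rewrite ?padeSS ?pade1 ?IH ?IH1; ring.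
Qed.

Lemma padeZ k c x y z j :
  pade k (c * x) (c * y) (c * z) j = c ^+ (2 * j) * pade k x y z j.
Proof.
elim/pade_ind: j => [||j IH IH1]; first by rewrite expr0 mul1r.
  by rewrite muln1 !pade1; ring.
rewrite !padeSS IH IH1 (_ : 2 * j.+1 = 2 * j + 2)%N; last lia.
rewrite (_ : 2 * j.+2 = 2 * j + 4)%N ?exprD; last lia.
ring.
Qed.

Lemma tangentZ k j c x y z :
  tangent k j (c * x) (c * y) (c * z)
  = c ^+ (2 * (k + j) + 1) * tangent k j x y z.
Proof.
rewrite /tangent parallelsZ padeZ (_ : 2 * (k + j) + 1 = 2 * k + 1 + 2 * j)%N.
  by rewrite !exprD; ring.
lia.
Qed.

Lemma tangentNl k j x y z : tangent k j (- x) y z = - tangent k j x y z.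
Proof. by rewrite /tangent parallelsN padeNl mulNr. Qed.

Lemma tangentNr k j x y z : tangent k j x (- y) z = tangent k j x y z.
Proof. by rewrite /tangent padeNr. Qed.

(** As for any three-term recurrence, one step multiplies the Casoratian of
    two consecutive terms by minus the coefficient of the older one.  The
    field can thus vanish only on the lines of the arrangement. *)
Lemma pade_wronskian k j x y z :
  pade k x y z j.+1 * pade k y x z j - pade k x y z j * pade k y x z j.+1
  = - (2 * (2 * k + 1))%:R
    * (\prod_(1 <= i < j.+1) ((4 * i ^ 2)%:R - (2 * k + 1)%:R ^+ 2))
    * parallels j (x - y) z * parallels j (x + y) z.
Proof.
elim: j => [|j IH]; first by rewrite big_geq // !parallels0 !pade1 /pade; ring.
rewrite !padeSS !parallelsS big_nat_recr //=.
set a := pade k x y z j; set b := pade k x y z j.+1.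
set a' := pade k y x z j; set b' := pade k y x z j.+1.
set t := (2 * k + 1)%:R ^+ 2 - (4 * j.+1 ^ 2)%:R.
transitivity (- t * ((x - y) ^+ 2 - (j.+1 ^ 2)%:R * z ^+ 2)
   * ((x + y) ^+ 2 - (j.+1 ^ 2)%:R * z ^+ 2) * (b * a' - a * b')).
  by ring.
by rewrite IH /t; ring.
Qed.

Lemma pade_diag_infinity k j :
  pade k 1 1 0 j = \prod_(0 <= i < j) (4 * (2 * i + 1))%:R :> R.
Proof.
elim/pade_ind: j => [||j IH IH1]; first by rewrite big_geq.
  by rewrite big_nat1 pade1; ring.
rewrite padeSS IH1 (big_nat_recr j.+1) //=; ring.
Qed.

(** On the outermost lines y = k z the polynomial has to vanish at the points
    where they meet the diagonals and anti-diagonals outside the grid; these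
    points are 2j in number, hence the complete factorization. *)
Lemma pade_boundary k j x z :
  pade k x (k%:R * z) z j =
  \prod_(1 <= i < j.+1) (((2 * i)%:R - (2 * k + 1)%:R) *
                         (x ^+ 2 - ((k + i) ^ 2)%:R * z ^+ 2)).
Proof.
elim/pade_ind: j => [||j IH IH1]; first by rewrite big_geq.
  by rewrite big_nat1 pade1; ring.
rewrite padeSS IH1 IH !(big_nat_recr j.+2) // (big_nat_recr j.+1) //=; ring.
Qed.

Lemma pade_axis_infinity k j :
  pade k 1 0 0 j = \prod_(1 <= i < j.+1) ((2 * i)%:R - (2 * k + 1)%:R) :> R.
Proof.
rewrite -[X in pade k 1 X](mulr0 k%:R) pade_boundary.
by apply: eq_bigr => i _; ring.
Qed.

Section Filtration.
Variable F : nat -> R -> Prop.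
Hypothesis F1 : F 0 1.
Hypothesis FD : forall d u v, F d u -> F d v -> F d (u + v).
Hypothesis FN : forall d u, F d u -> F d (- u).
Hypothesis FM : forall d e u v, F d u -> F e v -> F (d + e) (u * v).

(** The degree count for the field, made once for three filtrations: total
    degree of bivariate polynomials, homogeneous degree, and powers of an
    ideal. *)
Lemma tangent_filtered k j x y z :
  F 1 x -> F 1 y -> F 1 z -> F (2 * (k + j) + 1) (tangent k j x y z).
Proof.
move=> Fx Fy Fz.
have Fn n : F 0 n%:R.
  elim: n => [|n IH]; last by rewrite -addn1 natrD; apply: FD.
  by rewrite mulr0n -(subrr 1); apply/FD/FN.
have Fsq u : F 1 u -> F 2 (u ^+ 2) by rewrite expr2 => Fu; apply: (FM Fu Fu).
have Fnsq n u : F 1 u -> F 2 (n%:R * u ^+ 2).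
  by move=> Fu; apply/(FM (d := 0) (e := 2))/Fsq.
have FB d u v : F d u -> F d v -> F d (u - v) by move=> Fu Fv; apply/FD/FN.
have Fquad n : F 2 (2 * (x ^+ 2 + y ^+ 2) - n%:R * z ^+ 2).
  by apply/FB/Fnsq => //; rewrite mulrDr; apply: FD; apply/Fnsq.
rewrite (_ : 2 * (k + j) + 1 = (2 * k + 1) + 2 * j)%N; last lia.
apply: FM.
  elim: k => [|m IH]; first by rewrite parallels0.
  rewrite parallelsS (_ : 2 * m.+1 + 1 = 2 + (2 * m + 1))%N; last lia.
  by apply: FM IH; apply/FB/Fnsq/Fz/Fsq.
elim/pade_ind: j => [||j IH IH1]; first exact: F1.
  rewrite pade1 -[z ^+ 2]mul1r; apply/FB; first exact: (Fquad 1).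
  by rewrite mulrBr; apply/FB; apply/Fnsq.
rewrite padeSS; apply: FD.
  rewrite (_ : 2 * j.+2 = (0 + 2) + 2 * j.+1)%N; last lia.
  by apply/FM/IH1/FM.
rewrite (_ : 2 * j.+2 = ((0 + 2) + 2) + 2 * j)%N; last lia.
apply/FM/IH/FM; first apply: FM.
- by apply/FB; rewrite -?natrX.
- by apply/FB/Fnsq/Fz/Fsq/FB.
- by apply/FB/Fnsq/Fz/Fsq/FD.
Qed.

End Filtration.

End LinesAndForms.

Lemma rmorph_parallels (R S : comNzRingType) (f : {rmorphism R -> S}) m x z :
  f (parallels m x z) = parallels m (f x) (f z).
Proof.
by rewrite rmorph_prod; apply: eq_bigr => i _; rewrite rmorphB rmorphM rmorph_int.
Qed.

Lemma rmorph_pade (R S : comNzRingType) (f : {rmorphism R -> S}) k x y z j :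
  f (pade k x y z j) = pade k (f x) (f y) (f z) j.
Proof.
elim/pade_ind: j => [||j IH IH1]; first exact: rmorph1.
  by rewrite !pade1; ring.
rewrite !padeSS -IH -IH1; ring.
Qed.

Lemma rmorph_tangent (R S : comNzRingType) (f : {rmorphism R -> S}) k j x y z :
  f (tangent k j x y z) = tangent k j (f x) (f y) (f z).
Proof. by rewrite rmorphM rmorph_parallels rmorph_pade. Qed.

Arguments pade : simpl never.

(** * Tangency to the diagonals *)

Section TotalDegree.
Variable K : idomainType.
Implicit Types (A B : {poly {poly K}}).

(** Bivariate polynomials are polynomials in x with coefficients in K[c],
    where c is the intercept of the diagonal x - y = c. *)
Definition total_degree_le d A := forall m, (size (A`_m)%R <= d.+1 - m)%N.

Lemma total_degree_leW d e A :
  (d <= e)%N -> total_degree_le d A -> total_degree_le e A.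
Proof. by move=> le_de dA m; have := dA m; lia. Qed.

Lemma total_degree_leD d A B :
  total_degree_le d A -> total_degree_le d B -> total_degree_le d (A + B).
Proof.
move=> dA dB m; rewrite coefD (leq_trans (size_polyD _ _)) // geq_max.
by rewrite dA dB.
Qed.

Lemma total_degree_leN d A : total_degree_le d A -> total_degree_le d (- A).
Proof. by move=> dA m; rewrite coefN size_polyN. Qed.

Lemma total_degree_leM d e A B :
  total_degree_le d A -> total_degree_le e B ->
  total_degree_le (d + e) (A * B).
Proof.
move=> dA dB m; rewrite coefM (leq_trans (size_sum _ _ _)) //.
apply/bigmax_leqP => -[i /= lt_im] _; have [-> | nzA] := eqVneq A`_i 0.
  by rewrite mul0r size_poly0.
have [-> | nzB] := eqVneq B`_(m - i) 0; first by rewrite mulr0 size_poly0.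
have := dA i; have := dB (m - i)%N; have := size_polyMleq A`_i B`_(m - i).
move: nzA nzB; rewrite -!size_poly_gt0.
move: (size A`_i) (size B`_(m - i)) (size (A`_i * B`_(m - i))) => a b c; lia.
Qed.

Lemma total_degree_le1 : total_degree_le 0 1.
Proof.
by move=> m; rewrite coef1; case: eqP => [->|_]; rewrite ?size_poly1 ?size_poly0.
Qed.

Lemma total_degree_le_outer : total_degree_le 1 'X.
Proof.
by move=> m; rewrite coefX; case: eqP => [->|_]; rewrite ?size_poly1 ?size_poly0.
Qed.

Lemma total_degree_le_inner : total_degree_le 1 'X%:P.
Proof.
by move=> m; rewrite coefC; case: eqP => [->|_]; rewrite ?size_polyX ?size_poly0.
Qed.

End TotalDegree.

(** Write p = q r with r the product over [rs].  At a point of [ds] the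
    derivative of p is q times that of r, which is nonzero as r is separable;
    so q vanishes on [ds]. *)
Lemma double_roots_eq0 (K : fieldType) (p : {poly K}) (rs ds : seq K) :
    uniq rs -> uniq ds -> {subset ds <= rs} ->
    all (root p) rs -> all (root p^`()) ds ->
  (size p <= size rs + size ds)%N -> p = 0.
Proof.
move=> rs_uniq ds_uniq ds_rs p_rs p'_ds.
have [q def_p] : exists q : {poly K}, p = q * \prod_(x <- rs) ('X - x%:P).
  by apply: uniq_roots_prod_XsubC; rewrite ?uniq_rootsE.
set r := \prod_(_ <- _) _ in def_p; rewrite def_p => sz_p.
suff -> : q = 0 by rewrite mul0r.
have r_monic : r \is monic by apply: monic_prod_XsubC.
apply: (@roots_geq_poly_eq0 _ _ ds) => //; last first.
  have [->|nz_q] := eqVneq q 0; first by rewrite size_poly0.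
  by move: sz_p; rewrite size_Mmonic // size_prod_XsubC addnS /= addnC leq_add2l.
apply/allP => d ds_d; have := allP p'_ds d ds_d.
rewrite def_p derivM /root hornerD !hornerM.
have rd0 : root r d by rewrite root_prod_XsubC ds_rs.
rewrite (rootP rd0) mulr0 add0r mulf_eq0 => /orP[] //.
have : separable_poly r by rewrite separable_prod_XsubC.
by rewrite unlock => /coprimep_root/(_ rd0)/negPf->.
Qed.

(** The restriction to the line x - y = c of the difference of the two
    components: it vanishes exactly when the field is tangent to that line. *)
Definition defect (R : comNzRingType) k j (x c : R) : R :=
  tangent k j x (x - c) 1 - tangent k j (x - c) x 1.

Lemma rmorph_defect (R S : comNzRingType) (f : {rmorphism R -> S}) k j x c :
  f (defect k j x c) = defect k j (f x) (f c).
Proof. by rewrite rmorphB !rmorph_tangent rmorphB rmorph1. Qed.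

Lemma defectN (R : comNzRingType) k j (x c : R) :
  defect k j x (- c) = - defect k j (x + c) c.
Proof. by rewrite /defect opprK addrK opprB. Qed.

Lemma parallels_eq0 (R : comNzRingType) m (i : int) (z : R) :
  `|i| <= m%:Z -> parallels m (i%:~R * z) z = 0.
Proof.
rewrite -mem_sym_range => /perm_to_rem i_first.
by rewrite /parallels (perm_big _ i_first) big_cons subrr [LHS]mul0r.
Qed.

Section Core.
Variable K : numFieldType.
Variable k : nat.

Lemma horner_defect j (x c : K) : (defect k j 'X c%:P).[x] = defect k j x c.
Proof.
rewrite -[LHS]/(horner_eval x _) rmorph_defect.
by rewrite /= /horner_eval hornerX hornerC.
Qed.

(** The coefficient of x^m is a polynomial in c of degree at most
    2(k+j)+1-m, with the 2j+1 roots -j, ..., j; it is zero if m > 2k. *)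
Lemma size_defect j (c : K) :
    (forall i : int, `|i| <= j%:Z -> defect k j 'X (i%:~R : K)%:P = 0) ->
  (size (defect k j 'X c%:P) <= 2 * k + 1)%N.
Proof.
move=> defect0; apply/leq_sizeP => m le_km.
pose A : {poly {poly K}} := defect k j 'X 'X%:P.
have specA i : defect k j 'X i%:P = map_poly (horner_eval i) A.
  by rewrite rmorph_defect /= map_polyX map_polyC /= /horner_eval hornerX.
suff A0 : A`_m = 0 by rewrite specA coef_map /= A0 rmorph0.
have dA : total_degree_le (2 * (k + j) + 1) A.
  have dX := @total_degree_le_outer K.
  have dY : total_degree_le 1 ('X - 'X%:P : {poly {poly K}}).
    exact/total_degree_leD/total_degree_leN/total_degree_le_inner.
  have d1 : total_degree_le 1 (1 : {poly {poly K}}).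
    exact/(total_degree_leW _ (@total_degree_le1 _)).
  have dT x y := @tangent_filtered _ _ (@total_degree_le1 K)
    (@total_degree_leD K) (@total_degree_leN K) (@total_degree_leM K) k j x y 1.
  by apply/total_degree_leD/total_degree_leN; apply: dT.
apply: (@roots_geq_poly_eq0 _ _ [seq i%:~R | i <- sym_range j]).
- apply/allP => _ /mapP[l l_j ->]; apply/eqP; move: l_j.
  rewrite mem_sym_range => le_lj.
  have := congr1 (coefp m) (defect0 l le_lj).
  by rewrite specA /= coef0 coef_map.
- by rewrite map_inj_uniq ?sym_range_uniq //; apply: intr_inj.
- by rewrite size_map size_sym_range (leq_trans (dA m)) //; lia.
Qed.

Lemma deriv_defect j (m c : K) :
    parallels k m 1 = 0 -> parallels k (m - c) 1 = 0 ->
  (defect k j 'X c%:P)^`().[m] =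
    (parallels k 'X 1)^`().[m] * pade k m (m - c) 1 j
    - (parallels k 'X 1)^`().[m - c] * pade k (m - c) m 1 j.
Proof.
move=> pm0 pmc0.
have hornerP x : (parallels k 'X 1).[x] = parallels k x 1.
  by rewrite -[LHS]/(horner_eval x _) rmorph_parallels /= /horner_eval hornerX hornerC.
have hornerF (p q : {poly K}) x : (pade k p q 1 j).[x] = pade k p.[x] q.[x] 1 j.
  by rewrite -[LHS]/(horner_eval x _) rmorph_pade /= /horner_eval hornerC.
have -> : defect k j 'X c%:P =
    parallels k 'X 1 * pade k 'X ('X - c%:P) 1 j
    - (parallels k 'X 1 \Po ('X - c%:P)) * pade k ('X - c%:P) 'X 1 j.
  rewrite /defect /tangent; congr (_ - _ * _).
  by rewrite rmorph_parallels /= comp_polyX comp_polyC.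
rewrite derivB !derivM deriv_comp derivB derivX derivC subr0 mulr1.
rewrite !(hornerD, hornerN, hornerM, horner_comp, hornerX, hornerC, hornerP, hornerF).
by rewrite pm0 pmc0 !mul0r !addr0.
Qed.

Lemma deriv_parallelsN (x : K) :
  (parallels k 'X 1)^`().[- x] = (parallels k 'X 1)^`().[x].
Proof.
have : parallels k 'X 1 \Po (- 'X) = - parallels k 'X 1 :> {poly K}.
  by rewrite rmorph_parallels /= comp_polyX comp_polyC parallelsN.
move/(congr1 (fun p => (deriv p).[x])).
rewrite deriv_comp !derivN derivX mulrN mulr1 !hornerN horner_comp hornerN hornerX.
exact: oppr_inj.
Qed.

(** At a point (m, m - s) of the grid the vertical, horizontal and
    anti-diagonal lines meet.  Tangency to the anti-diagonal, which is the
    tangency to the diagonal of intercept 2m - s read through parity, forces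
    the derivative of the defect to vanish as well. *)
Lemma defect_reflect j (m s : K) :
    parallels k m 1 = 0 -> parallels k (m - s) 1 = 0 ->
    defect k j 'X (m *+ 2 - s)%:P = 0 -> (defect k j 'X s%:P)^`().[m] = 0.
Proof.
move=> pm0 pms0 defect0.
have Em : m - (m *+ 2 - s) = - (m - s) by ring.
have := deriv_defect j (c := m *+ 2 - s) pm0.
rewrite defect0 deriv0 horner0 Em parallelsN pms0 oppr0 => /(_ erefl).
by rewrite deriv_parallelsN padeNr padeNl deriv_defect.
Qed.

(** At x = -k the first component is zero, and the second one is known in
    closed form. *)
Lemma defect_boundary j (s : K) : s = j.+2%:R ->
  defect k j.+1 (- k%:R) s
    + ((2 * k + 1)%:R ^+ 2 - (4 * j.+1 ^ 2)%:R) * defect k j (- k%:R) s = 0.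
Proof.
move=> def_s.
have pk0 : parallels k (- k%:R : K) 1 = 0.
  by rewrite -mulrz_nat -intrN -[_%:~R]mulr1 parallels_eq0 //; lia.
rewrite /defect /tangent pk0 !mul0r !sub0r -!opprD !padeNl !padeNr.
have E i : pade k (k%:R + s) k%:R 1 i = pade k (k%:R + s) (k%:R * 1) 1 i.
  by rewrite mulr1.
rewrite !E !pade_boundary big_nat_recr //= def_s; ring.
Qed.

(** The diagonal has 2k-j-1 points in the grid, and j+1 of them lie on an
    anti-diagonal of intercept at most j and count twice.  With the point
    x = -k this makes 2k+1 roots, against a degree at most 2k. *)
Lemma defect_combination j (s : K) : (j < k)%N -> s = j.+2%:R ->
    (forall i : int, `|i| <= j%:Z -> defect k j 'X (i%:~R : K)%:P = 0) ->
    (forall i : int, `|i| <= j.+1%:Z -> defect k j.+1 'X (i%:~R : K)%:P = 0) ->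
  defect k j.+1 'X s%:P
    + ((2 * k + 1)%:R ^+ 2 - (4 * j.+1 ^ 2)%:R)%:P * defect k j 'X s%:P = 0.
Proof.
move=> lt_jk def_s defect0 defect1.
have p0 (i : int) : `|i| <= k%:Z -> parallels k (i%:~R : K) 1 = 0.
  by move=> le_ik; rewrite -[_%:~R]mulr1 parallels_eq0.
have Es : s = (j.+2%:Z)%:~R by rewrite def_s.
pose rs : seq int := - k%:Z :: [seq i%:Z + j.+2%:Z - k%:Z | i <- iota 0 (2 * k - j.+1)].
pose ds : seq int := [seq i%:Z | i <- iota 1 j.+1].
pose emb := fun i : int => i%:~R : K.
have emb_inj : injective emb by apply: intr_inj.
apply: (@double_roots_eq0 _ _ (map emb rs) (map emb ds)).
- rewrite map_inj_uniq //= map_inj_uniq ?iota_uniq ?andbT; last by move=> ? ? /=; lia.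
  by apply/mapP => -[l]; lia.
- by rewrite map_inj_uniq // map_inj_uniq ?iota_uniq // => ? ? /=; lia.
- move=> _ /mapP[_ /mapP[l l_j ->] ->]; move: l_j; rewrite mem_iota => lt_l.
  apply: map_f; rewrite inE; apply/orP; right; apply/mapP.
  by exists (l + k - j.+2)%N; rewrite ?mem_iota; lia.
- rewrite /= all_map; apply/andP; split.
    rewrite rootE hornerD hornerM hornerC !horner_defect /emb intrN -pmulrn.
    by rewrite defect_boundary.
  rewrite all_map; apply/allP => i; rewrite mem_iota => lt_i.
  rewrite /= rootE hornerD hornerM hornerC !horner_defect /defect /tangent Es.
  by rewrite /emb -intrB !p0 ?(mul0r, mulr0, subr0, addr0) //; lia.
- rewrite all_map; apply/allP => _ /mapP[l l_j ->]; move: l_j.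
  rewrite mem_iota => lt_l.
  rewrite /= rootE derivD derivM derivC mul0r add0r hornerD hornerM hornerC.
  have E : (emb l *+ 2 - s) = (l%:Z *+ 2 - j.+2%:Z)%:~R.
    by rewrite Es /emb; ring.
  rewrite !defect_reflect ?mulr0 ?addr0 // ?E ?Es ?defect0 ?defect1 //;
    by rewrite /emb -?intrB ?p0 //; lia.
- rewrite !size_map !size_iota /= size_map size_iota.
  apply: leq_trans (size_polyD _ _) _; rewrite geq_max.
  rewrite (leq_trans (size_defect _ defect1)); last lia.
  rewrite mul_polyC (leq_trans (size_scale_leq _ _)) //.
  by rewrite (leq_trans (size_defect _ defect0)) //; lia.
Qed.

Lemma defectSS (R : comNzRingType) j (x s : R) :
  defect k j.+2 x s =
    (2 * j + 3)%:R
      * ((2 * x - s) ^+ 2 + s ^+ 2 - (j.+2 ^ 2 + j.+1 ^ 2)%:R) * defect k j.+1 x s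
    + ((2 * k + 1)%:R ^+ 2 - (4 * j.+1 ^ 2)%:R) * (s ^+ 2 - (j.+1 ^ 2)%:R)
      * ((2 * x - s) ^+ 2 - (j.+1 ^ 2)%:R) * defect k j x s.
Proof. rewrite /defect /tangent !padeSS; ring. Qed.

Lemma defect_opp_eq0 j (c : K) :
  defect k j 'X c%:P = 0 -> defect k j 'X (- c)%:P = 0.
Proof.
move=> defect0; rewrite polyCN defectN.
have := rmorph_defect (comp_poly ('X + c%:P)) k j 'X c%:P.
by rewrite defect0 rmorph0 /= comp_polyX comp_polyC => <-; rewrite oppr0.
Qed.

(** The products for x and for x - 1 share all their factors but one. *)
Lemma parallels_shift (R : comNzRingType) (x : R) :
  (x + k%:R) * parallels k (x - 1) 1 = (x - k.+1%:R) * parallels k x 1.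
Proof.
elim: k => [|m IH]; first by rewrite !parallels0; ring.
rewrite !parallelsS; transitivity
  ((x + m.+1%:R) * (x - m.+2%:R) * ((x + m%:R) * parallels m (x - 1) 1)).
  by ring.
rewrite IH; ring.
Qed.

(** For |i| <= j the recurrence propagates vanishing, and for |i| = j+1 its
    second term has the factor i^2 - (j+1)^2; the case of |i| = j+2 is
    [defect_combination], up to a quadratic factor. *)
Lemma defect_eq0 j : (j <= k)%N ->
  forall i : int, `|i| <= j%:Z -> defect k j 'X (i%:~R : K)%:P = 0.
Proof.
elim/pade_ind: j => [_ | _ | j IH IH1 lt_jk] i le_ij.
- have -> : i = 0 by lia.
  by rewrite /defect subr0 subrr.
- have defect1 : defect k 1 'X (1%:~R : K)%:P = 0.
    rewrite /=; apply: (@mulfI _ ('X + k%:R)).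
      by rewrite -polyC_natr -[_%:P]opprK -polyCN polyXsubC_eq0.
    rewrite mulr0 /defect /tangent !pade1 mulrBr ![(_ + _) * (_ * _)]mulrA.
    rewrite parallels_shift; ring.
  have [->|[->|->]] : i = 1 \/ i = 0 \/ i = - 1 by lia.
  + exact: defect1.
  + by rewrite /defect subr0 subrr.
  + by rewrite intrN defect_opp_eq0.
have {}IH := IH (ltnW (ltnW lt_jk)); have {}IH1 := IH1 (ltnW lt_jk).
have defect2 : defect k j.+2 'X (j.+2%:Z%:~R : K)%:P = 0.
  have := defect_combination (ltnW lt_jk) (erefl _) IH IH1.
  rewrite defectSS; set u := defect _ _ _ _; set v := defect _ _ _ _.
  move=> B0.
  transitivity ((2 * j + 3)%:R * ((2 * 'X - j.+2%:R) ^+ 2 - (j.+1 ^ 2)%:R)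
    * (u + ((2 * k + 1)%:R ^+ 2 - (4 * j.+1 ^ 2)%:R)%:P * v)).
    by rewrite -pmulrn polyC_natr polyCB polyC_exp !polyC_natr; ring.
  by rewrite B0 mulr0.
have [->|[->|lt_ij]] : i = j.+2%:Z \/ i = - j.+2%:Z \/ `|i| <= j.+1%:Z by lia.
- exact: defect2.
- by rewrite intrN defect_opp_eq0.
rewrite defectSS IH1 // mulr0 add0r.
have [le_ij'|] : `|i| <= j%:Z \/ i ^+ 2 = j.+1%:Z ^+ 2.
  have [? | [-> | ->]] : `|i| <= j%:Z \/ i = j.+1%:Z \/ i = - j.+1%:Z by lia.
  - by left.
  - by right.
  - by right; rewrite sqrrN.
- by rewrite IH // mulr0.
move=> /(congr1 (fun l : int => l%:~R : K)); rewrite !rmorphXn /= -pmulrn => sq_i.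
rewrite -polyC_exp sq_i polyC_exp polyC_natr (natrX _ j.+1) subrr.
by rewrite !(mulr0, mul0r).
Qed.

End Core.

(** * Forms restricted to lines *)

Section LogarithmicField.
Variables (K : numFieldType) (k j : nat).
Implicit Types (x y z : K) (i : int).

Lemma tangent_vertical i x y z :
  `|i| <= k%:Z -> x = i%:~R * z -> tangent k j x y z = 0.
Proof. by move=> le_ik ->; rewrite /tangent parallels_eq0 ?mul0r. Qed.

Lemma tangent_diagonal i x y z : (j <= k)%N -> `|i| <= j%:Z ->
  x - y + i%:~R * z = 0 -> tangent k j x y z = tangent k j y x z.
Proof.
move=> le_jk le_ij xyz; have def_y : y = x + i%:~R * z.
  by rewrite -[LHS]addr0 -xyz; ring.
have [z0 | nz_z] := eqVneq z 0; first by rewrite def_y z0 mulr0 addr0.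
have le_Nij : `|- i| <= j%:Z by rewrite normrN.
have := congr1 (fun p => p.[x / z]) (@defect_eq0 K k j le_jk (- i) le_Nij).
rewrite horner_defect horner0 /defect intrN opprK => /eqP; rewrite subr_eq0.
have Ex : x = z * (x / z) by rewrite mulrCA divff ?mulr1.
have Ey : y = z * (x / z + i%:~R) by rewrite mulrDr -Ex def_y mulrC.
move=> Exy; transitivity (z ^+ (2 * (k + j) + 1) * tangent k j (x / z) (x / z + i%:~R) 1).
  by rewrite -tangentZ mulr1 -Ex -Ey.
by rewrite (eqP Exy) -tangentZ mulr1 -Ex -Ey.
Qed.

Lemma tangent_antidiagonal i x y z : (j <= k)%N -> `|i| <= j%:Z ->
  x + y + i%:~R * z = 0 -> tangent k j x y z = - tangent k j y x z.
Proof.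
move=> le_jk le_ij xyz.
rewrite -tangentNr -tangentNl; apply: (@tangent_diagonal i) => //.
by rewrite opprK.
Qed.

End LogarithmicField.

Lemma coefM_top (R : nzRingType) a b (p q : {poly R}) :
  (size p <= a.+1)%N -> (size q <= b.+1)%N -> (p * q)`_(a + b) = p`_a * q`_b.
Proof.
move=> sz_p sz_q; have lt_a : (a < (a + b).+1)%N by lia.
rewrite coefM (bigD1 (Ordinal lt_a)) //= addKn big1 ?addr0 // => -[l lt_l].
rewrite -val_eqE /= => neq_la; case: (ltnP a l) => [lt_al | le_la].
  by rewrite nth_default ?mul0r // (leq_trans sz_p).
by rewrite [q`_ _]nth_default ?mulr0 // (leq_trans sz_q) //; lia.
Qed.

Lemma size_polyM_top (R : nzRingType) a b (p q : {poly R}) :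
  (size p <= a.+1)%N -> (size q <= b.+1)%N -> (size (p * q)%R <= (a + b).+1)%N.
Proof.
move=> sz_p sz_q; rewrite (leq_trans (size_polyMleq _ _)) //.
by move: (leq_add sz_p sz_q); case: (_ + size q)%N => // s; rewrite addSn addnS.
Qed.

Section LineSubstitution.
Variables (R : comNzRingType) (n : nat).
Implicit Types (a b : 'I_n -> R) (g : {mpoly R[n]}).

Definition along_line a b g : {poly R} :=
  mmap polyC (fun i => (a i)%:P + b i *: 'X) g.

HB.instance Definition _ a b :=
  GRing.RMorphism.copy (along_line a b)
    (mmap polyC (fun i => (a i)%:P + b i *: 'X)).

Lemma horner_along_line a b g s :
  (along_line a b g).[s] = g.@[fun i => a i + b i * s].
Proof.
rewrite /along_line /mmap horner_sum mevalE; apply: eq_bigr => m _.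
rewrite hornerM hornerC /mmap1 horner_prod; congr (_ * _).
by apply: eq_bigr => i _; rewrite horner_exp hornerD hornerC hornerZ hornerX.
Qed.

(** Only the direction b contributes to the leading coefficient. *)
Lemma along_line_top a b g d : g \is d.-homog ->
  (size (along_line a b g) <= d.+1)%N /\ (along_line a b g)`_d = g.@[b].
Proof.
move=> /dhomogP hom_g; rewrite /along_line /mmap mevalE coef_sum.
suff top m : m \in msupp g ->
    (size (mmap1 (fun i => ((a i)%:P + b i *: 'X)%R) m) <= d.+1)%N /\
    (mmap1 (fun i => (a i)%:P + b i *: 'X) m)`_d = \prod_i b i ^+ m i.
  split.
    rewrite (leq_trans (size_sum _ _ _)) //; apply/bigmax_leqP_seq => m g_m _.
    rewrite mul_polyC (leq_trans (size_scale_leq _ _)) //.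
    by have [] := top m g_m.
  apply: eq_big_seq => m g_m; rewrite coefCM.
  by have [_ ->] := top m g_m.
move=> /hom_g deg_m; have <- : mdeg m = d by exact: deg_m.
rewrite /mmap1 mdegE.
elim/big_ind3: _ => [|p c u q e v [szp <-] [szq <-] | i _].
- by rewrite size_poly1 coef1.
- by rewrite coefM_top //; split=> //; apply: size_polyM_top.
elim: (m i) => [|l [szl coefl]]; first by rewrite size_poly1 coef1.
have szi : (size ((a i)%:P + b i *: 'X)%R <= 2)%N.
  rewrite (leq_trans (size_polyD _ _)) // geq_max (leq_trans (size_polyC_leq1 _)) //.
  by rewrite (leq_trans (size_scale_leq _ _)) // size_polyX.
rewrite !exprS; split; first exact: (@size_polyM_top _ 1 l).
by rewrite -[l.+1]add1n coefM_top // coefl coefD coefC coefZ coefX mulr1 add0r.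
Qed.

End LineSubstitution.

Lemma mcoeff_muni (R : comNzRingType) n (p : {mpoly R[n.+1]}) m :
  p@_m = ((muni p)`_(m ord_max))@_[multinom m (widen_ord (leqnSn n) i) | i < n].
Proof.
rewrite muniE coef_sum raddf_sum /= {1}[p]mpolyE raddf_sum /=.
apply: eq_bigr => m' _; rewrite mcoeffZ mcoeffX coefZ coefXn.
have [E|neq] := eqVneq (m ord_max) (m' ord_max); last first.
  rewrite mulr0 mcoeff0; have [Em|] := eqVneq m' m; last by rewrite mulr0.
  by rewrite Em eqxx in neq.
rewrite mulr1 mcoeffZ mcoeffX; congr (_ * (nat_of_bool _)%:R).
apply/eqP/eqP => [->//|/mnmP Em]; apply/mnmP => i.
have [lt_in | le_ni] := ltnP i n.
  have := Em (Ordinal lt_in); rewrite !mnmE.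
  by rewrite (_ : widen_ord _ _ = i) //; apply: val_inj.
suff -> : i = ord_max by [].
by apply: val_inj => /=; have := ltn_ord i; lia.
Qed.

Lemma poly_eval_eq0 (K : numFieldType) (p : {poly K}) :
  (forall x, p.[x] = 0) -> p = 0.
Proof.
move=> p0; apply: (@roots_geq_poly_eq0 _ _ [seq i%:R | i <- iota 0 (size p)]).
- by apply/allP => x _; rewrite rootE p0.
- by rewrite map_inj_uniq ?iota_uniq //; apply: mulrIn; apply: oner_neq0.
- by rewrite size_map size_iota.
Qed.

Lemma mpoly_eval_eq0 (K : numFieldType) n (p : {mpoly K[n]}) :
  (forall v, p.@[v] = 0) -> p = 0.
Proof.
elim: n => [|n IH] in p * => p0.
  by have := p0 (fun=> 0); rewrite (nvar0_mpolyC p) mevalC => ->; rewrite mpolyC0.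
apply/mpolyP => m; rewrite mcoeff_muni (IH (muni p)`_(m ord_max)) ?mcoeff0 // => v.
have -> : ((muni p)`_(m ord_max)).@[v] = (map_poly (meval v) (muni p))`_(m ord_max).
  by rewrite coef_map.
suff -> : map_poly (meval v) (muni p) = 0 by rewrite coef0.
apply: poly_eval_eq0 => c.
rewrite -(p0 (fun i => if insub (val i) is Some l then v l else c)) mevalE.
rewrite muniE rmorph_sum horner_sum /=; apply: eq_bigr => m' _.
rewrite map_polyZ map_polyXn hornerZ hornerXn /= mevalZ mevalX -mulrA.
congr (_ * _); rewrite big_ord_recr /= insubF ?ltnn //; congr (_ * _).
apply: eq_bigr => i _; rewrite mnmE; congr (_ ^+ _).
by rewrite insubT ?ltn_ord //= => lt_i; congr v; apply: val_inj.
Qed.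

(** * Powers of the ideal of a point *)

Section IdealPowers.
Variable (R : realType).
Local Notation C := R[i].
Local Notation S := {mpoly C[3]}.
Implicit Types (q v : 'rV[C]_3) (f g : S) (I : S -> Prop).

Definition point (a b c : C) : 'rV[C]_3 := \row_(i < 3) [:: a; b; c]`_i.

Lemma pointE v : v = point (v 0 0) (v 0 1) (v 0 2).
Proof.
apply/rowP => i; rewrite mxE.
by case: i => -[|[|[|]]] // lt_i /=; congr (v 0 _); apply: val_inj.
Qed.

Lemma evD f g v : ev (f + g) v = ev f v + ev g v.
Proof. exact: mevalD. Qed.

Lemma evM f g v : ev (f * g) v = ev f v * ev g v.
Proof. exact: mevalM. Qed.

Lemma evB f g v : ev (f - g) v = ev f v - ev g v.
Proof. exact: mevalB. Qed.

Lemma evS c f v : ev (c *: f) v = c * ev f v.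
Proof. exact: mevalZ. Qed.

Lemma ev_tangent k j x y z v :
  ev (tangent k j x y z) v = tangent k j (ev x v) (ev y v) (ev z v).
Proof. exact: (rmorph_tangent (meval (fun i => v 0 i))). Qed.

Lemma ev_X i v : ev 'X_i v = v 0 i.
Proof. exact: mevalXU. Qed.

Lemma evZ d f v (c : C) : f \is d.-homog -> ev f (c *: v) = c ^+ d * ev f v.
Proof.
move=> /dhomogP hom_f; rewrite /ev !mevalE mulr_sumr.
apply: eq_big_seq => m /hom_f deg_m; have <- : mdeg m = d by exact: deg_m.
rewrite mulrCA; congr (_ * _); rewrite mdegE -prodrXr -big_split /=.
by apply: eq_bigr => i _; rewrite mxE exprMn.
Qed.

Lemma ideal_exp0 I f : ideal_exp I 0 f.
Proof.
exists 1%N, (fun=> f), (fun _ _ => f); split=> [_ []//|].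
by rewrite big_ord1 big_ord0 mulr1.
Qed.

Lemma ideal_exp1 I f : I f -> ideal_exp I 1 f.
Proof.
move=> If; exists 1%N, (fun=> 1), (fun _ _ => f); split=> //.
by rewrite !big_ord1 mul1r.
Qed.

Lemma ideal_expD I t f g :
  ideal_exp I t f -> ideal_exp I t g -> ideal_exp I t (f + g).
Proof.
move=> [n [a [u [Iu ->]]]] [m [b [w [Iw ->]]]].
exists (n + m)%N, (fun i => match split i with inl l => a l | inr l => b l end).
exists (fun i => match split i with inl l => u l | inr l => w l end).
split=> [i l|]; first by case: (split i).
rewrite big_split_ord /=; congr (_ + _); apply: eq_bigr => i _.
  by rewrite (unsplitK (inl i)).
by rewrite (unsplitK (inr i)).
Qed.

Lemma ideal_exp_mull I t f g : ideal_exp I t g -> ideal_exp I t (f * g).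
Proof.
move=> [n [a [u [Iu ->]]]]; exists n, (fun i => f * a i), u; split=> //.
by rewrite mulr_sumr; apply: eq_bigr => i _; rewrite mulrA.
Qed.

Lemma ideal_expM I s t f g :
  ideal_exp I s f -> ideal_exp I t g -> ideal_exp I (s + t) (f * g).
Proof.
move=> [n [a [u [Iu ->]]]] It_g; rewrite mulr_suml.
have It0 : ideal_exp I (s + t) 0 by rewrite -(mul0r g); exists 0%N, (fun=> 0),
  (fun _ _ => 0); split=> [[]//|]; rewrite big_ord0 mul0r.
elim/big_ind: _ => [//|f1 f2|i _]; first exact: ideal_expD.
rewrite -mulrA; apply: ideal_exp_mull; move: It_g => [m [b [w [Iw ->]]]].
exists m, b, (fun l r => match split r with inl p => u i p | inr p => w l p end).
split=> [l r|]; first by case: (split r).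
rewrite mulr_sumr; apply: eq_bigr => l _.
rewrite mulrCA big_split_ord /=; congr (_ * (_ * _)); apply: eq_bigr => p _.
  by rewrite (unsplitK (inl p)).
by rewrite (unsplitK (inr p)).
Qed.

Lemma ideal_expN I t f : ideal_exp I t f -> ideal_exp I t (- f).
Proof. by rewrite -mulN1r; apply: ideal_exp_mull. Qed.

Lemma ideal_exp_tangent I k j x y z :
  I x -> I y -> I z -> ideal_exp I (2 * (k + j) + 1) (tangent k j x y z).
Proof.
move=> /ideal_exp1 Ix /ideal_exp1 Iy /ideal_exp1 Iz.
apply: (@tangent_filtered S (ideal_exp I)) => //.
- exact: ideal_exp0.
- exact: ideal_expD.
- exact: ideal_expN.
- exact: ideal_expM.
Qed.

Lemma dhomog_tangent k j (x y z : S) :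
    x \is 1.-homog -> y \is 1.-homog -> z \is 1.-homog ->
  tangent k j x y z \is (2 * (k + j) + 1).-homog.
Proof.
apply: (@tangent_filtered S (fun d f => f \is d.-homog)).
- exact: dhomog1.
- by move=> d f g; apply: rpredD.
- by move=> d f; rewrite rpredN.
- by move=> d e f g; apply: dhomogM.
Qed.

(** Along the line through q with direction v each generator of the ideal of
    q is divisible by the parameter, so g is divisible by its t-th power; as
    the degree is at most t+1, there are two terms only, and homogeneity turns
    this into affine dependence on mu. *)
Lemma fat_pencil t q g v (mu : C) :
    g \is t.+1.-homog -> ideal_exp (ideal_pt q) t g ->
  ev g (v + mu *: q) = ev g v + mu * (ev g (v + q) - ev g v).
Proof.
move=> hom_g fat_g.
pose L := along_line (fun i => q 0 i) (fun i => v 0 i) g.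
have evL s : L.[s] = ev g (q + s *: v).
  by rewrite horner_along_line; apply: meval_eq => i; rewrite !mxE mulrC.
have [r def_L] : exists r, L = r * 'X^t.
  have [n [a [u [qu def_g]]]] := fat_g.
  rewrite /L def_g rmorph_sum.
  elim/big_ind: _ => [|p1 p2 [r1 ->] [r2 ->]|i _]; first by exists 0; rewrite mul0r.
    by exists (r1 + r2); rewrite mulrDl.
  rewrite rmorphM rmorph_prod /=.
  suff [w ->] : exists w,
      \prod_(l < t) along_line (fun i => q 0 i) (fun i => v 0 i) (u i l) = w * 'X^t.
    by rewrite mulrA; eexists.
  elim: t u qu {hom_g fat_g def_g} => [|t IH] u qu.
    by exists 1; rewrite big_ord0 mul1r.
  rewrite big_ord_recr /=.
  have [w ->] := IH (fun i l => u i (widen_ord (leqnSn t) l)) (fun i l => qu i _).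
  have /factor_theorem [w' ->] :
      root (along_line (fun i => q 0 i) (fun i => v 0 i) (u i ord_max)) 0.
    rewrite rootE horner_along_line; apply/eqP; rewrite -[RHS](qu i ord_max 1).
    by rewrite scale1r; apply: meval_eq => l; rewrite mulr0 addr0.
  by exists (w * w'); rewrite subr0 exprSr !mulrA; congr (_ * _); rewrite mulrAC.
have [szL topL] := along_line_top (fun i => q 0 i) (fun i => v 0 i) hom_g.
rewrite -/L in szL topL.
have sz_r : (size r <= 2)%N.
  have [-> | nz_r] := eqVneq r 0; first by rewrite size_poly0.
  move: szL; rewrite def_L size_Mmonic ?monicXn // size_polyXn addnS /=.
  by rewrite -[t.+2]add2n leq_add2r.
have evr s : ev g (v + s *: q) = s * r`_0 + r`_1.
  have r1 : r`_1 = ev g v.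
    by rewrite -[RHS]topL def_L coefMXn ltnNge leqnSn subSnn.
  have [-> | nz_s] := eqVneq s 0; first by rewrite scale0r addr0 mul0r add0r r1.
  have -> : v + s *: q = s *: (q + s^-1 *: v).
    by rewrite scalerDr scalerA divff // scale1r addrC.
  rewrite (evZ _ _ hom_g) -evL def_L hornerM hornerXn exprVn.
  rewrite mulrCA exprS -mulrA divff ?expf_neq0 // mulr1.
  rewrite (horner_coef_wide _ sz_r) !big_ord_recr big_ord0 /= add0r expr0 mulr1 expr1.
  by rewrite mulrDl mulrC -mulrA mulVf // mulr1.
have := evr 0; have := evr 1; rewrite !(scale0r, scale1r, addr0) => -> ->.
by rewrite evr; ring.
Qed.

End IdealPowers.

(** * The curve attached to a point *)

(** The components of the vector product of q and X, as linear forms in X. *)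
HB.lock Definition cross0 (R : realType) (q : 'rV[R[i]]_3) : {mpoly R[i][3]} :=
  q 0 1 *: 'X_2 - q 0 2 *: 'X_1.
HB.lock Definition cross1 (R : realType) (q : 'rV[R[i]]_3) : {mpoly R[i][3]} :=
  q 0 2 *: 'X_0 - q 0 0 *: 'X_2.
HB.lock Definition cross2 (R : realType) (q : 'rV[R[i]]_3) : {mpoly R[i][3]} :=
  q 0 0 *: 'X_1 - q 0 1 *: 'X_0.

HB.lock Definition theta0 (R : realType) k j (q : 'rV[R[i]]_3) : {mpoly R[i][3]} :=
  tangent k j (cross0 q) (cross1 q) (cross2 q).
HB.lock Definition theta1 (R : realType) k j (q : 'rV[R[i]]_3) : {mpoly R[i][3]} :=
  tangent k j (cross1 q) (cross0 q) (cross2 q).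

HB.lock Definition curve (R : realType) k j (q : 'rV[R[i]]_3) : {mpoly R[i][3]} :=
  'X_0 * theta0 k j q + 'X_1 * theta1 k j q.

Section Curve.
Variables (R : realType) (k j : nat).
Local Notation C := R[i].
Local Notation S := {mpoly C[3]}.
Implicit Types (q v w h : 'rV[C]_3) (f g : S).

Local Notation theta0 := (theta0 k j).
Local Notation theta1 := (theta1 k j).
Local Notation curve := (curve k j).

Local Notation t := (2 * (k + j) + 1)%N.

(** The duals of all the lines but the line at infinity, whose dual is the
    point (0 : 0 : 1). *)
Definition affine_points : seq 'rV[C]_3 :=
  [seq point 1 0 (- i%:~R) | i <- sym_range k] ++
  [seq point 0 1 (- i%:~R) | i <- sym_range k] ++
  [seq point 1 (-1) i%:~R | i <- sym_range j] ++
  [seq point 1 1 i%:~R | i <- sym_range j].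

Lemma dual_config_complete_tictactoe :
  dual_config (@complete_tictactoe R k j) = point 0 0 1 :: affine_points.
Proof.
rewrite /dual_config /complete_tictactoe /tictactoe /affine_points /sym_range /=.
rewrite !map_cat -!map_comp; congr (_ :: _).
  by apply/rowP => -[[|[|[|]]] // lt_i]; rewrite !mxE mcoeffXU.
by congr (_ ++ (_ ++ (_ ++ _))); apply: eq_map => i;
  apply/rowP => -[[|[|[|]]] // lt_i]; rewrite !mxE !mcoeffD ?mcoeffN
    ?mcoeffD ?mcoeffN mcoeffZ !mcoeffXU /=
    ?(mulr0, mulr1, subr0, sub0r, addr0, add0r, oppr0).
Qed.

Lemma size_affine_points : size affine_points = (4 * (k + j) + 4)%N.
Proof. by rewrite /affine_points !size_cat !size_map !size_iota; lia. Qed.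

Lemma point0 (a b c : C) : point a b c 0 0 = a. Proof. by rewrite mxE. Qed.
Lemma point1 (a b c : C) : point a b c 0 1 = b. Proof. by rewrite mxE. Qed.
Lemma point2 (a b c : C) : point a b c 0 2 = c. Proof. by rewrite mxE. Qed.
Definition pointsE := (point0, point1, point2).

Lemma ev_cross0 q v : ev (cross0 q) v = q 0 1 * v 0 2 - q 0 2 * v 0 1.
Proof. by rewrite cross0.unlock evB !evS !ev_X. Qed.
Lemma ev_cross1 q v : ev (cross1 q) v = q 0 2 * v 0 0 - q 0 0 * v 0 2.
Proof. by rewrite cross1.unlock evB !evS !ev_X. Qed.
Lemma ev_cross2 q v : ev (cross2 q) v = q 0 0 * v 0 1 - q 0 1 * v 0 0.
Proof. by rewrite cross2.unlock evB !evS !ev_X. Qed.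
Definition ev_cross := (ev_cross0, ev_cross1, ev_cross2).

Lemma ev_theta0 q v :
  ev (theta0 q) v =
  tangent k j (ev (cross0 q) v) (ev (cross1 q) v) (ev (cross2 q) v).
Proof. by rewrite theta0.unlock; apply: ev_tangent. Qed.

Lemma ev_theta1 q v : ev (theta1 q) v =
  tangent k j (ev (cross1 q) v) (ev (cross0 q) v) (ev (cross2 q) v).
Proof. by rewrite theta1.unlock; apply: ev_tangent. Qed.

Lemma dhomog_cross q :
  [/\ cross0 q \is 1.-homog, cross1 q \is 1.-homog & cross2 q \is 1.-homog].
Proof.
by rewrite cross0.unlock cross1.unlock cross2.unlock; split; apply: rpredB;
  apply: rpredZ; rewrite dhomogX /= mdeg1.
Qed.

Lemma dhomog_theta q : theta0 q \is t.-homog /\ theta1 q \is t.-homog.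
Proof.
have [hom0 hom1 hom2] := dhomog_cross q.
by rewrite theta0.unlock theta1.unlock; split; apply: dhomog_tangent.
Qed.

Lemma theta_fat q :
  ideal_exp (ideal_pt q) t (theta0 q) /\ ideal_exp (ideal_pt q) t (theta1 q).
Proof.
have I0 : ideal_pt q (cross0 q) by move=> c; rewrite ev_cross0 !mxE; ring.
have I1 : ideal_pt q (cross1 q) by move=> c; rewrite ev_cross1 !mxE; ring.
have I2 : ideal_pt q (cross2 q) by move=> c; rewrite ev_cross2 !mxE; ring.
by rewrite theta0.unlock theta1.unlock; split; apply: ideal_exp_tangent.
Qed.

Lemma ev_curve q v :
  ev (curve q) v = v 0 0 * ev (theta0 q) v + v 0 1 * ev (theta1 q) v.
Proof.
have evXM i f : ev ('X_i * f) v = v 0 i * ev f v by rewrite evM ev_X.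
by rewrite curve.unlock; apply: etrans (evD _ _ _) _; congr (_ + _); apply: evXM.
Qed.

Lemma dhomog_curve q : curve q \is t.+1.-homog.
Proof.
have [hom0 hom1] := dhomog_theta q; rewrite curve.unlock -[t.+1]add1n.
have homX i : ('X_i : S) \is 1.-homog by rewrite dhomogX /= mdeg1.
exact: rpredD (dhomogM (homX 0) hom0) (dhomogM (homX 1) hom1).
Qed.

Lemma curve_fat q : ideal_exp (ideal_pt q) t (curve q).
Proof.
have [fat0 fat1] := theta_fat q; rewrite curve.unlock.
exact: ideal_expD (ideal_exp_mull _ fat0) (ideal_exp_mull _ fat1).
Qed.

(** The product of q and X does not change when X moves towards q. *)
Lemma ev_theta_translate q v w (mu : C) :
    (forall i, w 0 i = v 0 i + mu * q 0 i) ->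
  ev (theta0 q) w = ev (theta0 q) v /\ ev (theta1 q) w = ev (theta1 q) v.
Proof.
move=> def_w; rewrite !ev_theta0 !ev_theta1.
have -> : ev (cross0 q) w = ev (cross0 q) v by rewrite !ev_cross0 !def_w; ring.
have -> : ev (cross1 q) w = ev (cross1 q) v by rewrite !ev_cross1 !def_w; ring.
by have -> : ev (cross2 q) w = ev (cross2 q) v by rewrite !ev_cross2 !def_w; ring.
Qed.

Lemma ev_curve_translate q v w :
    (forall i, w 0 i = v 0 i + q 0 i) ->
  ev (curve q) w - ev (curve q) v =
  q 0 0 * ev (theta0 q) v + q 0 1 * ev (theta1 q) v.
Proof.
move=> def_w; have [i|E0 E1] := @ev_theta_translate q v w 1.
  by rewrite mul1r.
rewrite [ev (curve q) w]ev_curve [ev (curve q) v]ev_curve E0 E1 !def_w; ring.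
Qed.

Lemma curve_affine_points q (c : C) h : (j <= k)%N ->
  h \in affine_points -> ev (curve q) (c *: h) = 0.
Proof.
move=> le_jk; rewrite ev_curve ev_theta0 ev_theta1 !ev_cross !mem_cat.
by move=> /or4P[] /mapP[l]; rewrite mem_sym_range => le_l ->; rewrite !mxE /=;
  [ rewrite (@tangent_vertical _ k j l) //
  | rewrite (@tangent_vertical _ k j l (_ - q 0 0 * _)) //
  | rewrite (@tangent_diagonal _ k j l) //
  | rewrite (@tangent_antidiagonal _ k j l) // ]; ring.
Qed.

Lemma curve_in_ideal q : (j <= k)%N ->
  ideal_fat (dual_config (@complete_tictactoe R k j)) t q (curve q).
Proof.
move=> le_jk; split; last exact: curve_fat.
rewrite dual_config_complete_tictactoe => h; rewrite inE => /predU1P[-> c|].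
  by rewrite ev_curve !mxE /= mulr0 !mul0r addr0.
by move=> h_aff c; apply: curve_affine_points.
Qed.

End Curve.

(** * Uniqueness *)

Lemma parallels_eq0P (K : idomainType) m (x z : K) :
  parallels m x z = 0 -> exists2 i, i \in sym_range m & x = i%:~R * z.
Proof.
move/eqP; rewrite /parallels prodf_seq_eq0 => /hasP[i m_i].
by rewrite subr_eq0 => /eqP; exists i.
Qed.

(** At a common zero of the two components off the vertical and horizontal
    lines both [pade] factors vanish, hence so does their Wronskian. *)
Lemma tangent_eq0 (K : numFieldType) k j (x y z : K) : (0 < j)%N ->
    tangent k j x y z = 0 -> tangent k j y x z = 0 ->
  [\/ parallels k x z = 0, parallels k y z = 0,
      parallels j (x - y) z = 0 | parallels j (x + y) z = 0].
Proof.
case: j => // j _ /eqP; rewrite mulf_eq0 => /orP[/eqP|/eqP Fx]; first by constructor 1.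
move/eqP; rewrite mulf_eq0 => /orP[/eqP|/eqP Fy]; first by constructor 2.
move/eqP: (pade_wronskian k j x y z); rewrite Fx Fy mul0r mulr0 subr0 eq_sym.
rewrite !mulf_eq0 oppr_eq0 pnatr_eq0 => /orP[/orP[/orP[|]|]|].
- by rewrite muln_eq0 addn1.
- rewrite prodf_seq_eq0 => /hasP[i _] /=.
  by rewrite -natrX subr_eq0 eqr_nat => /eqP; lia.
- by move/eqP=> d0; constructor 3; rewrite parallelsS d0 mulr0.
- by move/eqP=> d0; constructor 4; rewrite parallelsS d0 mulr0.
Qed.

Section Uniqueness.
Variables (R : realType) (k j : nat).
Hypotheses (j_gt0 : (0 < j)%N) (le_jk : (j <= k)%N).
Local Notation C := R[i].
Local Notation S := {mpoly C[3]}.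
Local Notation t := (2 * (k + j) + 1)%N.
Local Notation origin := (point 0 0 1 : 'rV[C]_3).
Implicit Types (q v h : 'rV[C]_3) (f g : S).

(** The lines through q meet a fixed line through (0 : 0 : 1); this is the
    parameter there of the line through q and h. *)
Definition slope q h : C := - ev (cross0 q) h / ev (cross2 q) h.

(** The conditions on q used for uniqueness: the points of the configuration
    are seen from q in distinct directions, the field does not vanish where
    the line dual to q meets the arrangement, and the coefficient of mu in
    f(X + mu q), for f the curve of q, has the largest possible degree along
    the chord. *)
Definition generic q :=
  [/\ q 0 1 != 0,
      {in affine_points R k j, forall h, ev (cross2 q) h != 0},
      uniq [seq slope q h | h <- affine_points R k j],
      {in affine_points R k j, forall h,
         ev (theta0 k j q) h != 0 \/ ev (theta1 k j q) h != 0}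
    & q 0 0 * ev (theta0 k j q) origin + q 0 1 * ev (theta1 k j q) origin != 0].

Lemma theta_eq0_line q v :
    ev (theta0 k j q) v = 0 -> ev (theta1 k j q) v = 0 ->
  exists2 h, h \in affine_points R k j &
    h 0 0 * ev (cross0 q) v + h 0 1 * ev (cross1 q) v
      + h 0 2 * ev (cross2 q) v = 0.
Proof.
rewrite ev_theta0 ev_theta1; set x := ev (cross0 q) v; set y := ev (cross1 q) v.
set z := ev (cross2 q) v => th0 th1.
have opp_range m (i : int) : i \in sym_range m -> - i \in sym_range m.
  by rewrite !mem_sym_range normrN.
have [] := tangent_eq0 j_gt0 th0 th1 => /parallels_eq0P[i m_i def_x].
- exists (point 1 0 (- i%:~R)); last by rewrite !pointsE def_x; ring.
  by rewrite !mem_cat (map_f (fun i : int => point 1 0 (- i%:~R))).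
- exists (point 0 1 (- i%:~R)); last by rewrite !pointsE def_x; ring.
  by rewrite !mem_cat (map_f (fun i : int => point 0 1 (- i%:~R))) ?orbT.
- exists (point 1 (-1) (- i)%:~R).
    by rewrite !mem_cat (map_f (fun i : int => point 1 (-1) i%:~R)) ?opp_range ?orbT.
  rewrite !pointsE intrN; transitivity (x - y - i%:~R * z); first ring.
  by rewrite def_x subrr.
- exists (point 1 1 (- i)%:~R).
    by rewrite !mem_cat (map_f (fun i : int => point 1 1 i%:~R)) ?opp_range ?orbT.
  rewrite !pointsE intrN; transitivity (x + y - i%:~R * z); first ring.
  by rewrite def_x subrr.
Qed.

(** Two points of the line dual to q that are orthogonal to h are
    proportional; here they are the products of q with h and with v. *)
Lemma cross_parallel q h v :
    h 0 0 * ev (cross0 q) v + h 0 1 * ev (cross1 q) v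
      + h 0 2 * ev (cross2 q) v = 0 ->
  [/\ ev (cross2 q) h * ev (cross0 q) v = ev (cross2 q) v * ev (cross0 q) h,
      ev (cross2 q) h * ev (cross1 q) v = ev (cross2 q) v * ev (cross1 q) h
    & ev (cross2 q) h * ev (cross2 q) v = ev (cross2 q) v * ev (cross2 q) h].
Proof.
rewrite !ev_cross; set d := (X in X = 0) => d0; split.
- apply/eqP; rewrite -subr_eq0 -(mulr0 (- q 0 1)) -d0 /d; apply/eqP; ring.
- apply/eqP; rewrite -subr_eq0 -(mulr0 (q 0 0)) -d0 /d; apply/eqP; ring.
- exact: mulrC.
Qed.

(** The line through (1 : 0 : 0) and (0 : 0 : 1), which avoids q as soon as
    its second coordinate is nonzero. *)
Definition chord (s : C) := point 1 0 s.

Lemma theta_coprime q s : generic q ->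
  ev (theta0 k j q) (chord s) = 0 -> ev (theta1 k j q) (chord s) != 0.
Proof.
move=> [nz_q1 nz_c2 _ nz_th _] th0; apply/eqP => th1.
have [h aff_h /cross_parallel[E0 E1 E2]] := theta_eq0_line th0 th1.
have nz_v : ev (cross2 q) (chord s) != 0.
  by rewrite ev_cross !pointsE mulr0 sub0r mulr1 oppr_eq0.
have scale x y z x' y' z' :
    ev (cross2 q) h * x = ev (cross2 q) (chord s) * x' ->
    ev (cross2 q) h * y = ev (cross2 q) (chord s) * y' ->
    ev (cross2 q) h * z = ev (cross2 q) (chord s) * z' ->
    tangent k j x y z = 0 -> tangent k j x' y' z' = 0.
  move=> Ex Ey Ez T0; have := tangentZ k j (ev (cross2 q) h) x y z.
  rewrite T0 mulr0 Ex Ey Ez tangentZ => /eqP.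
  by rewrite mulf_eq0 expf_eq0 (negPf nz_v) andbF => /eqP.
move: th0 th1; rewrite ev_theta0 ev_theta1.
move=> /(scale _ _ _ _ _ _ E0 E1 E2) th0 /(scale _ _ _ _ _ _ E1 E0 E2) th1.
by have [] := nz_th h aff_h; rewrite ?ev_theta0 ?ev_theta1 ?th0 ?th1 eqxx.
Qed.

Lemma chord_slope q h : q 0 1 != 0 -> ev (cross2 q) h != 0 ->
  exists c mu : C, forall i,
    chord (slope q h) 0 i = c * h 0 i + mu * q 0 i.
Proof.
move=> nz_q1 nz_c2; exists (- q 0 1 / ev (cross2 q) h), (h 0 1 / ev (cross2 q) h).
rewrite /slope; move: nz_c2; rewrite ev_cross0 ev_cross2 => nz_c2.
move=> [[|[|[|]]] // lt_i]; rewrite mxE /=.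
- rewrite (_ : Ordinal lt_i = 0); last exact: val_inj.
  by field.
- rewrite (_ : Ordinal lt_i = 1); last exact: val_inj.
  by field.
- rewrite (_ : Ordinal lt_i = 2); last exact: val_inj.
  by field.
Qed.

Lemma chord_cone q v : q 0 1 != 0 -> q 0 1 * v 0 0 - q 0 0 * v 0 1 != 0 ->
  exists s mu c, v = c *: (chord s + mu *: q).
Proof.
move=> nz_q1 nz_a; set a := (X in X != 0) in nz_a.
exists ((q 0 1 * v 0 2 - q 0 2 * v 0 1) / a), (v 0 1 / a), (a / q 0 1).
apply/rowP => -[[|[|[|]]] // lt_i]; rewrite !mxE /=.
- by rewrite (_ : Ordinal lt_i = 0); [rewrite /a; field; apply/andP | apply: val_inj].
- by rewrite (_ : Ordinal lt_i = 1); [rewrite /a; field; apply/andP | apply: val_inj].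
- by rewrite (_ : Ordinal lt_i = 2); [rewrite /a; field; apply/andP | apply: val_inj].
Qed.

Definition on_chord f := along_line (fun i => chord 0 0 i) (fun i => origin 0 i) f.

(** The coefficient of mu in f(X + mu q), for f of degree t+1 with a t-fold
    point at q and X on the chord. *)
Definition on_shift q f :=
  along_line (fun i => chord 0 0 i + q 0 i) (fun i => origin 0 i) f - on_chord f.

Lemma horner_on_chord f s : (on_chord f).[s] = ev f (chord s).
Proof.
rewrite /on_chord horner_along_line; apply: meval_eq => i; rewrite !mxE.
by case: i => -[|[|[|]]] // ? /=; ring.
Qed.

Lemma horner_on_shift q f s :
  (on_shift q f).[s] = ev f (chord s + q) - ev f (chord s).
Proof.
rewrite hornerD hornerN horner_on_chord horner_along_line; congr (_ - _).
apply: meval_eq => i; rewrite !mxE.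
by case: i => -[|[|[|]]] // ? /=; ring.
Qed.

(** The coefficient of degree d+1 is the value of f at (0 : 0 : 1). *)
Lemma size_along_origin d v f : f \is d.+1.-homog -> ev f origin = 0 ->
  (size (along_line (fun i => v 0 i) (fun i => origin 0 i) f)%R <= d.+1)%N.
Proof.
move=> hom_f f0; apply/leq_sizeP => l; rewrite leq_eqVlt => /predU1P[<-|lt_l].
  by have [_ ->] := along_line_top (fun i => v 0 i) (fun i => origin 0 i) hom_f.
have [sz _] := along_line_top (fun i => v 0 i) (fun i => origin 0 i) hom_f.
by rewrite nth_default // (leq_trans sz).
Qed.

Lemma size_on_chord d q f : f \is d.+1.-homog -> ev f origin = 0 ->
  (size (on_chord f) <= d.+1)%N /\ (size (on_shift q f) <= d.+1)%N.
Proof.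
move=> hom_f f0; have sz0 := size_along_origin (chord 0) hom_f f0; split=> //.
rewrite (leq_trans (size_polyD _ _)) // size_polyN geq_max sz0 andbT.
have := size_along_origin (chord 0 + q) hom_f f0.
suff -> : along_line (fun i => (chord 0 + q) 0 i) (fun i => origin 0 i) f =
          along_line (fun i => chord 0 0 i + q 0 i) (fun i => origin 0 i) f by [].
apply/eqP; rewrite -subr_eq0; apply/eqP/poly_eval_eq0 => s.
rewrite hornerD hornerN !horner_along_line; apply/eqP; rewrite subr_eq0; apply/eqP.
by apply: meval_eq => i; rewrite !mxE.
Qed.

(** The ratio mu of the two restrictions does not depend on f.  So their
    cross product for two forms through h vanishes at the slope of h. *)
Lemma chord_at_slope q h d f (c mu : C) :
    f \is d.+1.-homog -> ideal_exp (ideal_pt q) d f -> ev f (c *: h) = 0 ->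
    (forall i, chord (slope q h) 0 i = c * h 0 i + mu * q 0 i) ->
  (on_chord f).[slope q h] = mu * (on_shift q f).[slope q h].
Proof.
move=> hom_f fat_f f0 def_chord; rewrite horner_on_shift horner_on_chord.
have -> : chord (slope q h) = c *: h + mu *: q.
  by apply/rowP => i; rewrite def_chord !mxE.
have -> : c *: h + mu *: q + q = c *: h + (mu + 1) *: q.
  by rewrite scalerDl scale1r addrA.
by rewrite !(fat_pencil _ _ hom_f fat_f) f0; ring.
Qed.

Lemma on_shift_curve q :
  on_shift q (curve k j q) =
  on_chord (q 0 0 *: theta0 k j q + q 0 1 *: theta1 k j q).
Proof.
apply/eqP; rewrite -subr_eq0; apply/eqP/poly_eval_eq0 => s.
rewrite hornerD hornerN horner_on_shift horner_on_chord.
rewrite (@ev_curve_translate _ k j q (chord s)) => [|i]; last by rewrite mxE.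
by rewrite evD !evS subrr.
Qed.

Lemma coprimep_curve q : generic q ->
  coprimep (on_chord (curve k j q)) (on_shift q (curve k j q)).
Proof.
move=> gen_q; apply/Pdiv.ClosedField.coprimepP => s.
rewrite rootE horner_on_chord ev_curve !mxE /= mul1r mul0r addr0 => /eqP th0.
rewrite on_shift_curve horner_on_chord evD !evS th0 mulr0 add0r mulf_neq0 //.
  by have [] := gen_q.
exact: theta_coprime.
Qed.

Lemma size_on_shift_curve q : generic q -> size (on_shift q (curve k j q)) = t.+1.
Proof.
move=> [_ _ _ _ nz_top]; rewrite on_shift_curve.
have [hom0 hom1] := dhomog_theta k j q.
have hom : q 0 0 *: theta0 k j q + q 0 1 *: theta1 k j q \is t.-homog.
  exact: rpredD (dhomogZ _ hom0) (dhomogZ _ hom1).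
have [sz top] := along_line_top (fun i => chord 0 0 i) (fun i => origin 0 i) hom.
apply/eqP; rewrite eqn_leq sz /=.
have : (on_chord (q 0 0 *: theta0 k j q + q 0 1 *: theta1 k j q))`_t != 0.
  by rewrite /on_chord top -[_.@[_]]/(ev _ origin) evD !evS.
by apply: contraNT; rewrite -leqNgt => sz'; rewrite nth_default.
Qed.

(** Outside the line joining q to (0 : 0 : 1) every vector is a multiple of
    X + mu q with X on the chord, so a form of the system is determined by its
    two restrictions. *)
Lemma fat_unique q g : generic q -> g \is t.+1.-homog ->
    ideal_fat (dual_config (@complete_tictactoe R k j)) t q g ->
  exists kappa : C, g = kappa *: curve k j q.
Proof.
move=> gen_q hom_g [Zg fat_g]; set f := curve k j q.
have [nz_q1 nz_c2 uniq_slope _ _] := gen_q.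
have hom_f : f \is t.+1.-homog by apply: dhomog_curve.
have [Zf fat_f] := curve_in_ideal q le_jk.
rewrite dual_config_complete_tictactoe in Zf Zg.
have f0 : ev f origin = 0 by rewrite -[origin]scale1r Zf ?mem_head.
have g0 : ev g origin = 0 by rewrite -[origin]scale1r Zg ?mem_head.
have [szf szf'] := size_on_chord q hom_f f0.
have [szg szg'] := size_on_chord q hom_g g0.
have cross_eq : on_chord g * on_shift q f = on_chord f * on_shift q g.
  apply/eqP; rewrite -subr_eq0; apply/eqP.
  apply: (@roots_geq_poly_eq0 _ _ [seq slope q h | h <- affine_points R k j]) => //.
    apply/allP => _ /mapP[h aff_h ->]; rewrite rootE hornerD hornerN !hornerM.
    have [c [mu def_chord]] := chord_slope nz_q1 (nz_c2 h aff_h).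
    have Zh f1 : ideal_pts (origin :: affine_points R k j) f1 -> ev f1 (c *: h) = 0.
      by move=> Zf1; apply: Zf1; rewrite inE aff_h orbT.
    rewrite (chord_at_slope hom_f fat_f (Zh f Zf) def_chord).
    rewrite (chord_at_slope hom_g fat_g (Zh g Zg) def_chord).
    by apply/eqP; ring.
  rewrite size_map size_affine_points (leq_trans (size_polyD _ _)) // size_polyN.
  rewrite geq_max (leq_trans (size_polyM_top szg szf'))
    ?(leq_trans (size_polyM_top szf szg')) //; lia.
have cop := coprimep_curve gen_q; have szS := size_on_shift_curve gen_q.
have nz_shift : on_shift q f != 0 by rewrite -size_poly_gt0 szS.
have /dvdpP[r def_r] : on_shift q f %| on_shift q g.
  rewrite -(Gauss_dvdpr _ (_ : coprimep (on_shift q f) (on_chord f))).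
    by rewrite -cross_eq dvdp_mull.
  by rewrite coprimep_sym.
have [kappa def_kappa] : exists kappa, r = kappa%:P.
  exists r`_0; apply: size1_polyC.
  have [-> | nz_r] := eqVneq r 0; first by rewrite size_poly0.
  move: szg'; rewrite def_r size_mul // szS addnS /= -[X in (_ <= X)%N]add1n.
  by rewrite leq_add2r.
have def_g : on_chord g = kappa *: on_chord f.
  apply: (mulIf nz_shift); rewrite cross_eq def_r def_kappa -mul_polyC; ring.
have def_g' : on_shift q g = kappa *: on_shift q f.
  by rewrite def_r def_kappa mul_polyC.
exists kappa.
have nz_l : q 0 1 *: 'X_0 - q 0 0 *: 'X_1 != 0 :> S.
  apply/eqP => /(congr1 (fun p => ev p (point 1 0 0)))/eqP.
  rewrite evB !evS !ev_X !mxE /= mulr1 mulr0 subr0 => q10.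
  by rewrite (_ : ev 0 _ = 0) ?(negPf nz_q1) // in q10; apply: meval0.
apply/eqP; rewrite -subr_eq0; apply/eqP/(mulIf nz_l); rewrite mul0r.
apply: mpoly_eval_eq0 => v0; pose v : 'rV[C]_3 := \row_i v0 i.
have -> p : p.@[v0] = ev p v by apply: meval_eq => i; rewrite mxE.
rewrite evM !evB !evS !ev_X.
set a := _ - q 0 0 * _; have [-> | nz_a] := eqVneq a 0; first by rewrite mulr0.
have [s [mu [c ->]]] := chord_cone nz_q1 nz_a.
rewrite (evZ _ _ hom_g) (evZ _ _ hom_f) (fat_pencil _ _ hom_g fat_g).
rewrite (fat_pencil _ _ hom_f fat_f) -!horner_on_shift -!horner_on_chord.
by rewrite def_g def_g' !hornerZ; ring.
Qed.

End Uniqueness.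

(** * Genericity *)

Lemma parallels_infinity (R : comNzRingType) m (x : R) :
  parallels m x 0 = x ^+ (2 * m + 1).
Proof.
rewrite /parallels (eq_bigr (fun=> x)) => [|i _]; last by rewrite mulr0 subr0.
by rewrite big_const_seq count_predT size_sym_range iter_mulr_1.
Qed.

Lemma tangent_axis_infinity (K : numFieldType) k j : tangent k j (1 : K) 0 0 != 0.
Proof.
rewrite /tangent parallels_infinity expr1n mul1r pade_axis_infinity.
by rewrite prodf_seq_neq0; apply/allP => i _ /=; rewrite subr_eq0 eqr_nat; lia.
Qed.

Lemma tangent_diag_infinity (K : numFieldType) k j : tangent k j (1 : K) 1 0 != 0.
Proof.
rewrite /tangent parallels_infinity expr1n mul1r pade_diag_infinity.
by rewrite prodf_seq_neq0; apply/allP => i _ /=; rewrite pnatr_eq0; lia.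
Qed.

Section Generic.
Variables (R : realType) (k j : nat).
Hypotheses (k_gt0 : (0 < k)%N).
Local Notation C := R[i].
Local Notation S := {mpoly C[3]}.
Local Notation t := (2 * (k + j) + 1)%N.
Local Notation origin := (point 0 0 1 : 'rV[C]_3).
Local Notation Z := (affine_points R k j).
Implicit Types (q v h : 'rV[C]_3) (f g : S).

Lemma ev_crossC q h :
  [/\ ev (cross0 q) h = - ev (cross0 h) q, ev (cross1 q) h = - ev (cross1 h) q
    & ev (cross2 q) h = - ev (cross2 h) q].
Proof. by split; rewrite ?ev_cross0 ?ev_cross1 ?ev_cross2; ring. Qed.

Lemma tangentN (x y z : C) : tangent k j (- x) (- y) (- z) = - tangent k j x y z.
Proof.
rewrite -[- x]mulN1r -[- y]mulN1r -[- z]mulN1r tangentZ.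
by rewrite -signr_odd oddD oddM /= expr1 mulN1r.
Qed.

(** The vector product is alternating and the field has odd degree, so the
    conditions on q may be read as values at q of fixed forms. *)
Lemma ev_thetaC q h :
  ev (theta0 k j q) h = - ev (theta0 k j h) q /\
  ev (theta1 k j q) h = - ev (theta1 k j h) q.
Proof.
have [E0 E1 E2] := ev_crossC q h.
by rewrite !ev_theta0 !ev_theta1 -!tangentN -E0 -E1 -E2.
Qed.

(** Among such vectors distinct ones are not proportional. *)
Definition normalized h := (h 0 0 == 1) || (h 0 0 == 0) && (h 0 1 == 1).

Lemma normalized_affine_points h : h \in Z -> normalized h.
Proof.
by rewrite !mem_cat => /or4P[] /mapP[l _ ->]; rewrite /normalized !mxE /= ?eqxx ?orbT.
Qed.

Lemma affine_points_uniq : uniq Z.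
Proof.
have neq1N1 : (1 == -1 :> C) = false.
  by rewrite -subr_eq0 opprK -[1 + 1]/(2%:R) pnatr_eq0.
have uniq_pencil (a b : C) (f : int -> C) m : injective f ->
    uniq [seq point a b (f l) | l <- sym_range m].
  move=> inj_f; rewrite map_inj_uniq ?sym_range_uniq // => l l'.
  by move/(congr1 (fun u : 'rV[C]_3 => u 0 2)); rewrite !mxE => /inj_f.
have inj_int : injective (fun l : int => l%:~R : C) by apply: intr_inj.
have inj_Nint : injective (fun l : int => - l%:~R : C).
  by move=> l l' /oppr_inj/inj_int.
have neqE : ((0 == 1 :> C) = false) * ((1 == 0 :> C) = false)
    * ((-1 == 0 :> C) = false) * ((0 == -1 :> C) = false)
    * ((1 == -1 :> C) = false) * ((-1 == 1 :> C) = false).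
  by rewrite ![_ == -1]eq_sym ![0 == 1]eq_sym oppr_eq0 oner_eq0 ![-1 == 1]eq_sym neq1N1.
rewrite !cat_uniq !uniq_pencil // !has_cat !negb_or /= ?andbT.
do ![apply/andP; split]; apply/hasPn => _ /mapP[l _ ->]; apply/mapP => -[l' _];
  move/rowP => eqp; have := eqp 0; have := eqp 1; rewrite !mxE /= => /eqP + /eqP;
  by rewrite ?neqE.
Qed.

(** Its value at q is, up to sign, q_1 times the determinant of q, h, h'. *)
Definition slope_gap h h' : S := cross0 h * cross2 h' - cross0 h' * cross2 h.

Lemma slope_gap_neq0 h h' :
  normalized h -> normalized h' -> h != h' -> slope_gap h h' != 0.
Proof.
move=> norm_h norm_h'; apply: contraNneq => gap0.
pose d q := q 0 0 * (h 0 1 * h' 0 2 - h 0 2 * h' 0 1)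
  + q 0 1 * (h 0 2 * h' 0 0 - h 0 0 * h' 0 2)
  + q 0 2 * (h 0 0 * h' 0 1 - h 0 1 * h' 0 0).
have d0 q : q 0 1 = 1 -> d q = 0.
  move=> q1; have : ev (slope_gap h h') q = 0 by rewrite gap0; apply: meval0.
  rewrite evB !evM !ev_cross0 !ev_cross2 /d q1 => E.
  by rewrite -[RHS]oppr0 -[in RHS]E; ring.
have := d0 (point 0 1 0) (point1 _ _ _); have := d0 (point 1 1 0) (point1 _ _ _).
have := d0 (point 0 1 1) (point1 _ _ _); rewrite /d !pointsE.
rewrite !mul0r !mul1r !add0r !addr0 => E2 E0 E1; rewrite E1 ?add0r ?addr0 in E0 E2.
rewrite (pointE h) (pointE h'); move: norm_h norm_h'.
rewrite /normalized => /orP[/eqP h0|/andP[/eqP h0 /eqP h1]].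
  case/orP => [/eqP h0'|/andP[/eqP h0' /eqP h1']].
    move/eqP: E1; rewrite h0 h0' mul1r mulr1 subr_eq0 => /eqP ->.
    by move/eqP: E2; rewrite h0 h0' mul1r mulr1 subr_eq0 => /eqP ->.
  by move/eqP: E2; rewrite h0 h0' h1' mulr1 mulr0 subr0 oner_eq0.
case/orP => [/eqP h0'|/andP[/eqP h0' /eqP h1']].
  by move/eqP: E2; rewrite h0 h0' h1 mul0r mulr1 sub0r oppr_eq0 oner_eq0.
rewrite h0 h0' h1 h1'; move/eqP: E0; rewrite h1 h1' mul1r mulr1 subr_eq0.
by move=> /eqP ->.
Qed.

(** A component of the field that is not identically zero on the line dual
    to [h]: on a vertical line the first one vanishes. *)
Definition theta_on h : S := if h 0 1 == 0 then theta1 k j h else theta0 k j h.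

Lemma theta_on_neq0 h : h \in Z -> theta_on h != 0.
Proof.
move=> aff_h; suff: ev (theta_on h) origin != 0.
  by apply: contraNneq => ->; rewrite (_ : ev 0 _ = 0) //; apply: meval0.
move: aff_h; rewrite /theta_on !mem_cat.
by move=> /or4P[] /mapP[l _ ->]; rewrite !mxE /= ?eqxx ?oner_eq0 ?oppr_eq0 ?oner_eq0;
  rewrite ?ev_theta0 ?ev_theta1 ev_cross0 ev_cross1 ev_cross2 !mxE /=;
  rewrite ?(mulr0, mul0r, mulr1, mul1r, subr0, sub0r, oppr0);
  rewrite ?tangentNl ?tangentNr ?oppr_eq0 ?tangent_axis_infinity ?tangent_diag_infinity.
Qed.

(** With F for [pade] at z = 0, the value at (s : 1 : 0) is
    s^(2k+1) F(s,1) - s F(1,s), whose coefficient of s is - F(1,0). *)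
Lemma curve_origin_neq0 : curve k j origin != 0.
Proof.
apply/eqP => curve0.
pose p : {poly C} := 'X^(2 * k) * pade k 'X 1 0 j - pade k 1 'X 0 j.
suff /eqP : 'X * p = 0.
  rewrite mulf_eq0 polyX_eq0 /= => /eqP /(congr1 (horner_eval 0)).
  rewrite rmorphB rmorphM !rmorph_pade /= /horner_eval !hornerE.
  rewrite expr0n muln_eq0 /= eqn0Ngt k_gt0 mul0r sub0r => /eqP.
  have := tangent_axis_infinity C k j.
  by rewrite /tangent parallels_infinity expr1n mul1r oppr_eq0 => /negPf->.
apply: poly_eval_eq0 => s.
have : ev (curve k j origin) (point s 1 0) = 0 by rewrite curve0; apply: meval0.
rewrite ev_curve ev_theta0 ev_theta1 !ev_cross !mxE /=.
rewrite ?(mulr0, mul0r, mulr1, mul1r, subr0, sub0r) tangentNl tangentNr.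
rewrite oppr0 /tangent !parallels_infinity expr1n addn1 exprS => curve_s.
rewrite -[RHS]curve_s !hornerE -![(pade _ _ _ _ _).[s]]/(horner_eval s _).
rewrite !rmorph_pade /= /horner_eval !hornerE; ring.
Qed.

Definition genericity : S :=
  'X_1 * curve k j origin * (\prod_(h <- Z) (cross2 h * theta_on h))
    * \prod_(h <- Z) \prod_(h' <- Z | h' != h) slope_gap h h'.

Lemma genericity_neq0 : genericity != 0.
Proof.
rewrite !mulf_neq0 //.
- by rewrite -msize_poly_eq0 msizeX.
- exact: curve_origin_neq0.
- rewrite prodf_seq_neq0; apply/allP => h aff_h /=.
  rewrite mulf_neq0 ?theta_on_neq0 //.
  have ev_neq0 v : ev (cross2 h) v != 0 -> cross2 h != 0.
    by apply: contraNneq => ->; rewrite (_ : ev 0 _ = 0) //; apply: meval0.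
  have := normalized_affine_points aff_h; rewrite /normalized.
  case/orP => [/eqP h0|/andP[/eqP h0 /eqP h1]].
    apply: (ev_neq0 (point 0 1 0)).
    by rewrite ev_cross2 !pointsE h0 mul1r mulr0 subr0 oner_eq0.
  apply: (ev_neq0 (point 1 0 0)).
  by rewrite ev_cross2 !pointsE h0 h1 mul0r mul1r sub0r oppr_eq0 oner_eq0.
- rewrite prodf_seq_neq0; apply/allP => h aff_h /=.
  rewrite prodf_seq_neq0; apply/allP => h' aff_h' /=; apply/implyP => neq_h.
  by rewrite slope_gap_neq0 ?normalized_affine_points // eq_sym.
Qed.

Lemma dhomog_genericity : exists d, genericity \is d.-homog.
Proof.
pose hom f := exists d, f \is d.-homog.
have homM f g : hom f -> hom g -> hom (f * g).
  by move=> [d hom_f] [e hom_g]; exists (d + e)%N; apply: dhomogM.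
have homP (r : seq 'rV[C]_3) (P : pred 'rV[C]_3) (F : 'rV[C]_3 -> S) :
    (forall h, hom (F h)) -> hom (\prod_(h <- r | P h) F h).
  by move=> homF; apply: big_ind => //; exists 0%N; apply: dhomog1.
have hom_cross h : [/\ hom (cross0 h), hom (cross1 h) & hom (cross2 h)].
  by have [? ? ?] := dhomog_cross h; split; exists 1%N.
apply/homM; first apply/homM; first apply/homM.
- by exists 1%N; rewrite dhomogX /= mdeg1.
- by eexists; apply: dhomog_curve.
- apply/homP => h; apply/homM; first by have [] := hom_cross h.
  rewrite /theta_on; have [hom0 hom1] := dhomog_theta k j h.
  by case: ifP => _; exists t.
- apply/homP => h; apply/homP => h'; exists 2%N.
  have [h0 _ h2] := dhomog_cross h; have [h0' _ h2'] := dhomog_cross h'.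
  exact: rpredB (dhomogM h0 h2') (dhomogM h0' h2).
Qed.

Lemma generic_of_genericity q : ev genericity q != 0 -> generic k j q.
Proof.
have ev_prod (r : seq 'rV[C]_3) (P : pred 'rV[C]_3) (F : 'rV[C]_3 -> S) :
    ev (\prod_(h <- r | P h) F h) q = \prod_(h <- r | P h) ev (F h) q.
  exact: (rmorph_prod (meval (fun i => q 0 i))).
rewrite /genericity !evM !ev_prod !mulf_eq0 !negb_or ev_X.
move=> /andP[/andP[/andP[nz_q1 nz_top] nz_h] nz_gap].
have {nz_h} nz_h h : h \in Z -> ev (cross2 q) h != 0 /\ ev (theta_on h) q != 0.
  move=> aff_h; move: nz_h; rewrite prodf_seq_neq0 => /allP/(_ h aff_h) /=.
  rewrite evM mulf_eq0 negb_or => /andP[nz_c ?]; split=> //.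
  by have [_ _ ->] := ev_crossC q h; rewrite oppr_eq0.
split=> [//|h /nz_h[]//||h aff_h|].
- rewrite map_inj_in_uniq ?affine_points_uniq // => h h' aff_h aff_h' eq_slope.
  apply/eqP/idPn => neq_h; move: nz_gap; rewrite prodf_seq_neq0.
  move=> /allP/(_ h aff_h) /=; rewrite ev_prod prodf_seq_neq0.
  move=> /allP/(_ h' aff_h') /=; rewrite eq_sym neq_h /= => /eqP[].
  have [nz_h2 _] := nz_h h aff_h; have [nz_h2' _] := nz_h h' aff_h'.
  have [E0 _ E2] := ev_crossC q h; have [E0' _ E2'] := ev_crossC q h'.
  move: eq_slope nz_h2 nz_h2'; rewrite /slope evB !evM E0 E0' E2 E2' !oppr_eq0.
  set a := ev (cross0 h) q; set a' := ev (cross0 h') q.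
  set b := ev (cross2 h) q; set b' := ev (cross2 h') q => /eqP.
  rewrite !invrN !opprK !mulrN !eqr_opp => + nz_b nz_b'; rewrite eqr_div //.
  by move=> /eqP->; rewrite subrr.
- have [_ +] := nz_h h aff_h; have [-> ->] := ev_thetaC q h.
  by rewrite !oppr_eq0 /theta_on; case: ifP => _; [right | left].
- have [-> ->] := ev_thetaC q origin.
  by move: nz_top; rewrite ev_curve !mulrN -opprD oppr_eq0.
Qed.

Lemma generic_for_general_point (P : 'rV[C]_3 -> Prop) :
  (forall q, generic k j q -> P q) -> for_general_point P.
Proof.
move=> genP; exists (eq genericity); split=> [_ <-||q _ nz_q].
- exact: dhomog_genericity.
- have [q nz_q] : exists q, ev genericity q != 0.
    apply: contrapT => no_q; have /eqP[] := genericity_neq0.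
    apply: mpoly_eval_eq0 => v; apply: contrapT => /eqP nz_v.
    apply: no_q; exists (\row_i v i); apply: contraNneq nz_v => <-.
    by apply/eqP; apply: meval_eq => i; rewrite mxE.
  exists q; split=> [|/(_ _ erefl)]; last exact/eqP.
  have [nz_q1 _ _ _ _] := generic_of_genericity nz_q.
  by apply: contraNneq nz_q1 => ->; rewrite mxE.
- apply/genP/generic_of_genericity/eqP => q0.
  by apply: nz_q => _ <-.
Qed.

End Generic.

(** * Independence of the conditions imposed by the points *)

Section IndependentConditions.
Variable (R : realType).
Local Notation C := R[i].
Local Notation S := {mpoly C[3]}.

Definition separates d (s : seq 'rV[C]_3) p (f : S) :=
  [/\ f \is d.-homog, ev f p != 0
    & forall p', p' \in s -> p' != p -> ev f p' = 0].

(** Separating forms show that the evaluation map is onto. *)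
Lemma dim_ideal_pts d (s : seq 'rV[C]_3) : uniq s ->
    (forall p, p \in s -> exists f, separates d s p f) ->
  exists2 n, dim_part (ideal_pts s) d n & (n + size s = 'C(d + 2, d))%N.
Proof.
move=> s_uniq sep.
pose E (f : dhomog 3 C d) : 'rV[C]_(size s) := \row_(l < size s) ev f (nth 0 s l).
have linE : linear E.
  by move=> c f g; apply/rowP => l; rewrite !mxE /= evD evS.
pose EL : {linear dhomog 3 C d -> 'rV[C]_(size s)} :=
  HB.pack E (GRing.isLinear.Build _ _ _ _ E linE).
pose V := lker (linfun EL).
exists (\dim V).
  exists V => // f; rewrite memv_ker lfunE /=; split.
    move=> /eqP E0 p s_p c; rewrite (evZ _ _ (dhomog_is_dhomog f)).
    have lt_p : (index p s < size s)%N by rewrite index_mem.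
    have := congr1 (fun r : 'rV_(size s) => r 0 (Ordinal lt_p)) E0.
    by rewrite !mxE /= nth_index // => ->; rewrite mulr0.
  move=> Zf; apply/eqP/rowP => l; rewrite !mxE.
  by have := Zf _ (mem_nth 0 (ltn_ord l)) 1; rewrite scale1r.
transitivity (\dim (fullv : {vspace dhomog 3 C d})); last by rewrite dimvf.
rewrite -(limg_ker_dim (linfun EL) fullv) capfv; congr (_ + _)%N.
suff -> : limg (linfun EL) = fullv by rewrite dimvf /dim /= mul1n.
apply/eqP; rewrite eqEsubv subvf /=; apply/subvP => r _.
have sepP (l : 'I_(size s)) : {f | separates d s (nth 0 s l) f}.
  exact/cid/sep/mem_nth.
pose f (l : 'I_(size s)) : dhomog 3 C d :=
  DHomog (let: And3 hom _ _ := svalP (sepP l) in hom).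
have -> : r = linfun EL (\sum_l (r 0 l / ev (f l) (nth 0 s l)) *: f l).
  rewrite lfunE linear_sum; apply/rowP => l; rewrite summxE (bigD1 l) //=.
  rewrite big1 => [|l' neq_l].
    rewrite addr0 mxE evS /= divfK //.
    by have [] := svalP (sepP l).
  rewrite mxE evS /=; have [_ _ sep0] := svalP (sepP l').
  have neq_nth : nth 0 s l != nth 0 s l' by rewrite nth_uniq // eq_sym.
  by rewrite (sep0 _ (mem_nth 0 (ltn_ord l)) neq_nth) mulr0.
exact: memv_img (memvf _).
Qed.

End IndependentConditions.

Section Separators.
Variables (R : realType) (k j : nat).
Hypotheses (j_gt0 : (0 < j)%N) (le_jk : (j <= k)%N).
Local Notation C := R[i].
Local Notation S := {mpoly C[3]}.
Local Notation t := (2 * (k + j) + 1)%N.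
Local Notation origin := (point 0 0 1 : 'rV[C]_3).
Local Notation Z := (affine_points R k j).
Local Notation x := ('X_0 : S).
Local Notation y := ('X_1 : S).
Local Notation z := ('X_2 : S).

Lemma dhomog_linear (a b c : C) : a *: x + b *: y + c *: z \is 1.-homog.
Proof.
by do ![apply: rpredD]; apply: rpredZ; rewrite dhomogX /= mdeg1.
Qed.

Definition pencil_prod (r : seq int) (a b : C) : S :=
  \prod_(l <- r) ((a * l%:~R) *: x + (b * l%:~R) *: y + 1 *: z).

Lemma dhomog_pencil_prod r a b : pencil_prod r a b \is (size r).-homog.
Proof.
rewrite /pencil_prod; elim: r => [|l r IH]; first by rewrite big_nil dhomog1.
by rewrite big_cons; apply: (dhomogM (dhomog_linear _ _ _) IH).
Qed.

Lemma ev_pencil_prod r a b v : ev (pencil_prod r a b) v =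
  \prod_(l <- r) ((a * v 0 0 + b * v 0 1) * l%:~R + v 0 2).
Proof.
rewrite /pencil_prod -[LHS]/(meval _ _) rmorph_prod; apply: eq_bigr => l _.
rewrite -[LHS]/(ev _ v) !evD !evS !ev_X; ring.
Qed.

(** The points other than (0 : 0 : 1) lie on four lines through it.  The
    linear forms u, l and l' kill three of these lines, the power of u
    filling up the degree, and the last product kills the points of the
    fourth one but that of index i. *)
Definition separator (m n : nat) (i : int) (u l l' : S) (a b : C) : S :=
  u ^+ (2 * n) * (l * l') * pencil_prod (rem i (sym_range m)) a b.

Lemma dhomog_separator m n i u l l' a b : i \in sym_range m ->
    u \is 1.-homog -> l \is 1.-homog -> l' \is 1.-homog ->
  separator m n i u l l' a b \is (2 * (m + n) + 2).-homog.
Proof.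
move=> m_i hu hl hl'; have := dhomog_pencil_prod (rem i (sym_range m)) a b.
rewrite size_rem // size_sym_range addn1 /= => hp.
rewrite (_ : 2 * (m + n) + 2 = 1 * (2 * n) + (1 + 1) + 2 * m)%N; last lia.
exact: dhomogM (dhomogM (dhomogMn _ hu) (dhomogM hl hl')) hp.
Qed.

Lemma ev_separator m n i u l l' a b v :
  ev (separator m n i u l l' a b) v =
  ev u v ^+ (2 * n) * (ev l v * ev l' v)
    * \prod_(r <- rem i (sym_range m)) ((a * v 0 0 + b * v 0 1) * r%:~R + v 0 2).
Proof.
rewrite !evM ev_pencil_prod; congr (_ * _ * _).
exact: (rmorphXn (meval (fun i => v 0 i))).
Qed.

Lemma separator_pencil m i (c w : C) l :
    l \in sym_range m -> c != 0 -> w = - (c * l%:~R) ->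
  (\prod_(r <- rem i (sym_range m)) (c * r%:~R + w) == 0) = (l != i).
Proof.
move=> m_l nz_c ->; rewrite prodf_seq_eq0.
apply/hasP/idP => [[l' +] /=|neq_li].
  rewrite -mulrBr mulf_eq0 (negPf nz_c) subr_eq0 eqr_int => + /eqP <-.
  by rewrite mem_rem_uniq ?sym_range_uniq // => /andP[].
exists l; last by rewrite /= subrr.
by rewrite mem_rem_uniq ?sym_range_uniq // inE neq_li.
Qed.

(** For (0 : 0 : 1) itself, lines joining the points on the four lines in
    pairs, none of them through (0 : 0 : 1), have the right number. *)
Lemma separated p : p \in origin :: Z ->
  exists f, separates t.+1 (origin :: Z) p f.
Proof.
have X1 (l : 'I_3) : ('X_l : S) \is 1.-homog by rewrite dhomogX /= mdeg1.
have hP : x + y \is 1.-homog by apply: rpredD.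
have hM : x - y \is 1.-homog by apply: rpredB.
have k_gt0 : (0 < k)%N by lia.
rewrite inE => /predU1P[-> | ].
  exists (pencil_prod (sym_range k) 1 1 * pencil_prod (sym_range j) (-1) 0).
  split.
  - rewrite (_ : t.+1 = size (sym_range k) + size (sym_range j))%N.
      by apply: dhomogM; apply: dhomog_pencil_prod.
    by rewrite !size_sym_range; lia.
  - rewrite evM !ev_pencil_prod !mxE /= !mulr0 addr0.
    by rewrite mulf_neq0 // prodf_seq_neq0; apply/allP => l _ /=;
      rewrite mul0r add0r oner_eq0.
  - move=> p'; rewrite inE => /predU1P[-> | ]; first by rewrite eqxx.
    move=> aff_p' _; rewrite evM !ev_pencil_prod; apply/eqP.
    rewrite mulf_eq0 !prodf_seq_eq0; move: aff_p'.
    rewrite !mem_cat => /or4P[] /mapP[l m_l ->]; apply/orP;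
    [left | left | right | right]; apply/hasP; exists l => //=;
      rewrite !mxE /=; apply/eqP; ring.
have two_neq0 : (1 + 1 != 0 :> C) by rewrite -[1 + 1]/(2%:R) pnatr_eq0.
have exp0 n : (0 < n)%N -> (0 : C) ^+ (2 * n) = 0.
  by move=> n_gt0; rewrite expr0n muln_eq0 (gtn_eqF n_gt0).
have sepI m n i u l l' (a b : C) q : (m + n = k + j)%N -> i \in sym_range m ->
    [/\ u \is 1.-homog, l \is 1.-homog & l' \is 1.-homog] ->
    ev u q != 0 -> ev l q != 0 -> ev l' q != 0 ->
    a * q 0 0 + b * q 0 1 != 0 -> q 0 2 = - ((a * q 0 0 + b * q 0 1) * i%:~R) ->
    (forall v, v \in origin :: Z -> v != q ->
       ev (separator m n i u l l' a b) v = 0) ->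
  exists f, separates t.+1 (origin :: Z) q f.
  move=> def_mn m_i [hu hl hl'] nz_u nz_l nz_l' nz_c def_q sep0.
  exists (separator m n i u l l' a b); split=> //.
    by rewrite (_ : t.+1 = 2 * (m + n) + 2)%N ?dhomog_separator //; lia.
  rewrite ev_separator mulf_neq0 // ?(separator_pencil _ m_i) ?eqxx //.
  by rewrite !mulf_neq0 ?expf_neq0.
have sepE := (ev_separator, evB, evD, ev_X, pointsE).
have simpl0 := (exp0 _ j_gt0, exp0 _ k_gt0, subrr, addNr, mulr0, mul0r).
have pencil0 m i l (c w d : C) :
    l \in sym_range m -> c != 0 -> w = - (c * l%:~R) -> l != i ->
  d * \prod_(r <- rem i (sym_range m)) (c * r%:~R + w) = 0.
  move=> m_l nz_c def_w neq_li; apply/eqP; rewrite mulf_eq0.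
  by rewrite (separator_pencil _ m_l) ?neq_li ?orbT.
rewrite !mem_cat => /or4P[] /mapP[i m_i ->].
- apply: (sepI k j i x (x + y) (x - y) 1 0); rewrite ?sepE //=;
    rewrite ?(mulr0, mul0r, mulr1, mul1r, addr0, subr0) ?oner_eq0 //.
  move=> v; rewrite inE => /predU1P[->|]; first by rewrite !sepE !simpl0.
  rewrite !mem_cat => /or4P[] /mapP[l m_l ->] neq_p; rewrite !sepE ?simpl0 //.
  have neq_li : l != i by apply: contraNneq neq_p => ->.
  by rewrite (pencil0 _ _ l) // ?mulr1 ?mul0r ?add0r ?addr0 ?mul1r ?mulN1r ?opprK
    ?oppr_eq0 ?oner_eq0.
- apply: (sepI k j i y (x + y) (x - y) 0 1); rewrite ?sepE //=;
    rewrite ?(mulr0, mul0r, mulr1, mul1r, addr0, add0r, sub0r) ?oppr_eq0 ?oner_eq0 //.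
  move=> v; rewrite inE => /predU1P[->|]; first by rewrite !sepE !simpl0.
  rewrite !mem_cat => /or4P[] /mapP[l m_l ->] neq_p; rewrite !sepE ?simpl0 //.
  have neq_li : l != i by apply: contraNneq neq_p => ->.
  by rewrite (pencil0 _ _ l) // ?mulr1 ?mul0r ?add0r ?addr0 ?mul1r ?mulN1r ?opprK
    ?oppr_eq0 ?oner_eq0.
- apply: (sepI j k i x y (x - y) (-1) 0); rewrite ?sepE 1?addnC //=;
    rewrite ?(mulr0, mul0r, mulr1, mul1r, addr0, opprK) ?mulN1r ?opprK
      ?oppr_eq0 ?oner_eq0 //.
  move=> v; rewrite inE => /predU1P[->|]; first by rewrite !sepE !simpl0.
  rewrite !mem_cat => /or4P[] /mapP[l m_l ->] neq_p; rewrite !sepE ?simpl0 //.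
  have neq_li : l != i by apply: contraNneq neq_p => ->.
  by rewrite (pencil0 _ _ l) // ?mulr1 ?mul0r ?add0r ?addr0 ?mul1r ?mulN1r ?opprK
    ?oppr_eq0 ?oner_eq0.
- apply: (sepI j k i x y (x + y) (-1) 0); rewrite ?sepE 1?addnC //=;
    rewrite ?(mulr0, mul0r, mulr1, mul1r, addr0, opprK) ?mulN1r ?opprK
      ?oppr_eq0 ?oner_eq0 //.
  move=> v; rewrite inE => /predU1P[->|]; first by rewrite !sepE !simpl0.
  rewrite !mem_cat => /or4P[] /mapP[l m_l ->] neq_p; rewrite !sepE ?simpl0 //.
  have neq_li : l != i by apply: contraNneq neq_p => ->.
  by rewrite (pencil0 _ _ l) // ?mulr1 ?mul0r ?add0r ?addr0 ?mul1r ?mulN1r ?opprK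
    ?oppr_eq0 ?oner_eq0.
Qed.

End Separators.

(** * The unexpected curve *)

Lemma dim_fat_generic (R : realType) k j (q : 'rV[R[i]]_3) :
    (0 < j)%N -> (j <= k)%N -> generic k j q ->
  dim_part (ideal_fat (dual_config (@complete_tictactoe R k j))
    (2 * (k + j) + 1) q) (2 * (k + j) + 1).+1 1.
Proof.
move=> j_gt0 le_jk gen_q; pose f := DHomog (dhomog_curve k j q).
exists (<[f]>)%VS => [g|].
  split=> [/vlineP[kappa ->] | fat_g].
    have [Zf fat_f] := curve_in_ideal q le_jk; split=> /= [p Zp c|].
      by rewrite evS Zf ?mulr0.
    by rewrite -mul_mpolyC; apply: ideal_exp_mull.
  have [kappa def_g] := fat_unique j_gt0 le_jk gen_q (dhomog_is_dhomog g) fat_g.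
  by apply/vlineP; exists kappa; apply: val_inj.
rewrite dim_vline; suff -> : f != 0 by [].
apply/eqP => /(congr1 val) /= f0; have := size_on_shift_curve gen_q.
by rewrite f0 /on_shift /on_chord !rmorph0 subrr size_poly0.
Qed.

Theorem theorem3p21 (R : realType) (k j : nat)
    (k_gt0 : (0 < k)%N) (j_gt0 : (0 < j)%N) (le_jk : (j <= k)%N) :
  admits_unique_unexpected_curve (dual_config (@complete_tictactoe R k j))
    (2 * (k + j + 1))%N.
Proof.
have def_d : (2 * (k + j + 1) = (2 * (k + j) + 1).+1)%N by lia.
split; exists (2 * (k + j) + 1)%N => //.
  apply: (@generic_for_general_point R k j) => // q gen_q.
  have Z_uniq : uniq (dual_config (@complete_tictactoe R k j)).
    rewrite dual_config_complete_tictactoe /= affine_points_uniq andbT.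
    apply/negP => /(normalized_affine_points); rewrite /normalized !mxE /=.
    by rewrite (eq_sym 0) oner_eq0 andbF.
  have sep p : p \in dual_config (@complete_tictactoe R k j) ->
      exists f, separates (2 * (k + j) + 1).+1
        (dual_config (@complete_tictactoe R k j)) p f.
    by rewrite dual_config_complete_tictactoe; apply: separated.
  have [n dim_n card_n] := dim_ideal_pts Z_uniq sep.
  exists 1%N, n; split=> //; first exact: dim_fat_generic.
  suff -> : n = 'C((2 * (k + j) + 1).+1, 2) by rewrite subrr maxxx.
  move: card_n; rewrite dual_config_complete_tictactoe /= size_affine_points.
  have sym d : 'C(d + 2, d) = 'C(d + 2, 2) by rewrite -{2}(addnK 2 d) bin_sub ?leq_addl.
  by rewrite sym addn2 !binS !bin1 !bin0; lia.
exact: (generic_for_general_point k_gt0 (fun q => dim_fat_generic j_gt0 le_jk)).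
Qed.
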